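(* Let $\beta$ be a braid with closure $\mathcal{L}_\beta\subset S^3$, let $w_\beta$ be its writhe, and let $\{\widehat\beta\}_\circ$ be the associated linear combination of collections of labeled essential circles in the annulus (see context). Then: (1) for every $n\ge 1$, $P_n(\mathcal{L}_\beta)$ is equal to $q^{n w_\beta}$ times the element of $\mathbb{Z}[q,q^{-1}]$ obtained from $\{\widehat\beta\}_\circ$ by assigning to each $k$-labeled circle the value ${n+k-1\brack k}$ (multiplicatively over the circles of a collection); (2) $P_\infty(\mathcal{L}_\beta)$ is equal to $a^{w_\beta}$ times the element obtained from $\{\widehat\beta\}_\circ$ by assigning to each $k$-labeled circle the value $$\mathsf{c}_{\mathrm{Sym}^k}:=q^{k}a^{-k}\prod_{i=1}^k\frac{1-a^2q^{2i-2}}{1-q^{2i}} .$$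
   Context: $[k]=\frac{q^k-q^{-k}}{q-q^{-1}}$ are quantum integers and ${k\brack l}$ are quantum binomial coefficients. Webs. A (braid-like) web is an upward-directed planar trivalent graph in a strip, with edges labeled by positive integers, built from merges $(k,l)\to k+l$ and splits $k+l\to(k,l)$. Its annular closure is a web in the annulus. Webs are taken up to isotopy and modulo the $\mathbb{Z}[q,q^{-1}]$-linear local relations (and those obtained from these by symmetry or by reversing all orientations): (i) associativity: the two ways of merging $(k,l,p)$ to $k+l+p$ are equal; (ii) digon removal: $k{+}l\to(k,l)\to k{+}l$ equals ${k+l\brack l}$ times the identity strand; (iii) square relation: on strands $(k,l)$, the web moving a $1$-labeled edge from the left strand to the right strand and then a $1$-labeled edge back, minus the web moving a $1$-labeled edge from the right strand to the left and then one back, equals $[k-l]$ times the identity. Bracket. For a braid $\beta$ (strands directed upward, labeled $1$), $\{\beta\}$ is obtained by replacing each positive crossing (over-strand going from bottom left to top right) by $-q\,\mathrm{Id}+E$ and each negative crossing by $E-q^{-1}\mathrm{Id}$, where $\mathrm{Id}$ is two parallel strands and $E$ is the web $(1,1)\to 2\to(1,1)$. The writhe $w_\beta$ is the number of positive minus the number of negative crossings. $\{\widehat\beta\}$ is the annular closure. Using only relations (i)–(iii) (and their symmetric versions) the annular closure of every braid-like web can be written as a $\mathbb{Z}[q,q^{-1}]$-linear combination of collections of concentric essential circles labeled by positive integers; the resulting expression of $\{\widehat\beta\}$ is denoted $\{\widehat\beta\}_\circ$, and it is unique once the labels are required to be radially non-decreasing. Link polynomials. $P_n$ is the (uncolored,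 framing-independent) $\mathfrak{sl}_n$ Reshetikhin–Turaev polynomial, satisfying $q^{-n}P_n(L_+)-q^{n}P_n(L_-)=(q^{-1}-q)P_n(L_0)$ with value $[n]$ on the unknot. $P_\infty$ is the HOMFLYPT polynomial, the unique link invariant with $a^{-1}P_\infty(L_+)-aP_\infty(L_-)=(q^{-1}-q)P_\infty(L_0)$ and value $\frac{a-a^{-1}}{q-q^{-1}}$ on the unknot. Here $L_\pm$ have a positive/negative crossing and $L_0$ its oriented resolution. *)

(* Defs.v *)
From HB Require Import structures.
From mathcomp Require Import all_boot all_order all_algebra.
From mathcomp Require Import boolp.
From mathcomp Require Import finmap monalg.

Set Implicit Arguments.
Unset Strict Implicit.
Unset Printing Implicit Defensive.

Import GRing.Theory.
Local Open Scope ring_scope.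

Definition Qq : fieldType := {fraction {poly int}}.
Definition qF : Qq := tofrac ('X : {poly int}).

(* Z[q, q^-1] as a subring of Q(q) *)
Definition laurent : {pred Qq} :=
  fun x => `[< exists (n : nat) (p : {poly int}), x * qF ^+ n = tofrac p >].

Lemma qF_neq0 : qF != 0.
Proof. by rewrite /qF tofrac_eq0 polyX_eq0. Qed.

Lemma laurentP x :
  reflect (exists (n : nat) (p : {poly int}), x * qF ^+ n = tofrac p)
          (x \in laurent).
Proof. exact: asboolP. Qed.

Fact laurent_subring : subring_closed laurent.
Proof.
split=> [|x y /laurentP[n [p Hp]] /laurentP[k [r Hr]]
        |x y /laurentP[n [p Hp]] /laurentP[k [r Hr]]]; apply/laurentP.
- by exists 0%N, 1; rewrite mulr1 tofrac1.
- exists (n + k)%N, (p * 'X^k - r * 'X^n).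
  rewrite tofracB !tofracM !tofracXn -Hp -Hr -/qF.
  by rewrite mulrBl -!mulrA -!exprD (addnC k).
- exists (n + k)%N, (p * r).
  by rewrite tofracM -Hp -Hr exprD mulrACA.
Qed.

HB.instance Definition _ :=
  GRing.isSubringClosed.Build Qq laurent laurent_subring.

Record Zq := MkZq { Zq_val :> Qq; _ : Zq_val \in laurent }.

HB.instance Definition _ := [isSub for Zq_val].
HB.instance Definition _ := [Choice of Zq by <:].
HB.instance Definition _ := [SubChoice_isSubComNzRing of Zq by <:].

Lemma laurent_exprz (k : int) : qF ^ k \in laurent.
Proof.
apply/laurentP; case: k => n; first by exists 0%N, ('X^n); rewrite mulr1 tofracXn.
exists n.+1, 1; rewrite NegzE -exprnN mulVf ?tofrac1 //.
by rewrite expf_neq0 // qF_neq0.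
Qed.

Definition qpow (k : int) : Zq := MkZq (laurent_exprz k).

Definition qintF (k : int) : Qq := (qF ^ k - qF ^ (- k)) / (qF - qF^-1).

Definition qbinF (n l : nat) : Qq :=
  \prod_(i < l) (qintF (n%:Z - i%:Z) / qintF i.+1%:Z).

Lemma qF_exp_neq (n : nat) : qF ^ n.+1%:Z - qF ^ (- n.+1%:Z) != 0.
Proof.
have h : qF ^+ n.+1 != 0 by rewrite expf_neq0 // qF_neq0.
rewrite -exprnN -exprnP; apply: contraNneq h => /(congr1 ( *%R (qF ^+ n.+1))).
rewrite mulr0 mulrBr mulfV ?expf_neq0 ?qF_neq0 // -exprD => /eqP.
rewrite subr_eq0 -tofracXn -tofrac1 tofrac_eq => /eqP /(congr1 (size \o val)) /=.
by rewrite size_polyXn size_poly1.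
Qed.

Lemma qF_den_neq0 : qF - qF^-1 != 0.
Proof. exact: (qF_exp_neq 0). Qed.

Lemma qintFS_neq0 (n : nat) : qintF n.+1%:Z != 0.
Proof. by rewrite mulf_neq0 ?invr_eq0 ?qF_exp_neq ?qF_den_neq0. Qed.

Lemma qintFD (k l : int) : qintF (k + l) = qF ^ l * qintF k + qF ^ (- k) * qintF l.
Proof.
rewrite /qintF !mulrA -mulrDl !mulrBr -!expfzDr ?qF_neq0 //.
by rewrite (addrC l k) (addrC l (- k)) addrA subrK opprD.
Qed.

Lemma qintF_laurent (k : int) : qintF k \in laurent.
Proof.
have nat_case (n : nat) : qintF n%:Z \in laurent.
  elim: n => [|n IHn]; first by rewrite /qintF oppr0 subrr mul0r rpred0.
  rewrite -addn1 PoszD qintFD [qintF 1](divff qF_den_neq0) mulr1.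
  by apply: rpredD; [apply: rpredM|]; rewrite ?laurent_exprz.
case: k => n; first exact: nat_case.
rewrite NegzE (_ : qintF _ = - qintF n.+1%:Z) ?rpredN //.
by rewrite /qintF opprK -mulNr opprB.
Qed.

Lemma qbinF_recr (n l : nat) :
  qbinF n l.+1 = qbinF n l * (qintF (n%:Z - l%:Z) / qintF l.+1%:Z).
Proof. by rewrite /qbinF big_ord_recr. Qed.

Lemma qbinF_recl (n l : nat) :
  qbinF n.+1 l.+1 = qintF n.+1%:Z / qintF l.+1%:Z * qbinF n l.
Proof.
have E (a b x c d : Qq) : a * b * x * (c * d) = a * d * (x * (c * b)).
  rewrite -!mulrA; congr (_ * _).
  rewrite mulrCA [RHS]mulrCA; congr (_ * _).
  by rewrite [RHS]mulrCA mulrC -mulrA.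
elim: l => [|l IHl].
  by rewrite /qbinF big_ord_recr !big_ord0 /= subr0 mul1r mulr1.
rewrite qbinF_recr IHl qbinF_recr.
have -> : n.+1%:Z - l.+1%:Z = n%:Z - l%:Z.
  by rewrite !intS opprD addrACA subrr add0r.
exact: E.
Qed.

Lemma qbinF_laurent (n l : nat) : qbinF n l \in laurent.
Proof.
elim: n l => [|n IHn] [|l]; try by rewrite /qbinF big_ord0 rpred1.
  have q0 : qintF 0 = 0 by rewrite /qintF oppr0 subrr mul0r.
  by rewrite /qbinF big_ord_recl [qintF _]q0 !mul0r rpred0.
have E (a b c d : Qq) : a * b * c * d = a * (d * (b * c)).
  by rewrite -!mulrA; congr (_ * _); rewrite mulrA mulrC.
suff -> : qbinF n.+1 l.+1 = qF ^ l.+1%:Z * qbinF n l.+1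
                          + qF ^ (- (n%:Z - l%:Z)) * qbinF n l.
  by apply: rpredD; apply: rpredM; rewrite ?laurent_exprz ?IHn.
have h := qintFS_neq0 l.
rewrite qbinF_recl qbinF_recr.
have -> : n.+1%:Z = (n%:Z - l%:Z) + l.+1%:Z by rewrite !intS addrCA subrK.
rewrite qintFD mulrDl mulrDl; congr (_ + _); last by rewrite mulfK.
exact: E.
Qed.

Definition qint (k : int) : Zq := MkZq (qintF_laurent k).
Definition qbin (n l : nat) : Zq := MkZq (qbinF_laurent n l).

(* Diagrams in a strip in generic position: a diagram is a word of slices, read
   from bottom to top, and the slice (s, g, t) is a single generating piece g
   with vertical strands labelled s to its left and t to its right.  Objects are
   the sequences of labels met by a horizontal line. *)

Section Words.
Variables (X : eqType) (G : Type) (src tgt : G -> seq X).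
Implicit Types (a b s t m : seq X) (g h : G) (w : seq (seq X * G * seq X)).

Fixpoint is_word w a b : bool :=
  if w is (s, g, t) :: w' then
    (a == s ++ src g ++ t) && is_word w' (s ++ tgt g ++ t) b
  else a == b.

Definition whisker s w t : seq (seq X * G * seq X) :=
  [seq (s ++ sl.1.1, sl.1.2, sl.2 ++ t) | sl <- w].

(* g and h placed side by side, separated by the strands m: g first / h first. *)
Definition left_first g m h : seq (seq X * G * seq X) :=
  [:: ([::], g, m ++ src h); (tgt g ++ m, h, [::])].
Definition right_first g m h : seq (seq X * G * seq X) :=
  [:: (src g ++ m, h, [::]); ([::], g, m ++ tgt h)].

Lemma is_word_cat w1 w2 a b c :
  is_word w1 a b -> is_word w2 b c -> is_word (w1 ++ w2) a c.
Proof.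
elim: w1 a => [|[[s g] t] w1 IHw] a /=; first by move/eqP->.
by case/andP=> -> /IHw/[apply].
Qed.

End Words.

Definition lin (K : choiceType) (V : lmodType Zq) (f : K -> V)
    (x : {malg Zq[K]}) : V :=
  \sum_(k <- msupp x) x@_k *: f k.

Inductive vertex := Merge of nat & nat | Split of nat & nat.

Definition vertex_code (g : vertex) : bool * nat * nat :=
  match g with Merge k l => (true, k, l) | Split k l => (false, k, l) end.
Definition vertex_decode (c : bool * nat * nat) : vertex :=
  let: (e, k, l) := c in if e then Merge k l else Split k l.
Fact vertex_codeK : cancel vertex_code vertex_decode.
Proof. by case. Qed.
HB.instance Definition _ := Choice.copy vertex (can_type vertex_codeK).

Definition vsrc (g : vertex) : seq nat :=
  match g with Merge k l => [:: k; l] | Split k l => [:: (k + l)%N] end.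
Definition vtgt (g : vertex) : seq nat :=
  match g with Merge k l => [:: (k + l)%N] | Split k l => [:: k; l] end.

Definition vertex_pos (g : vertex) : bool :=
  match g with Merge k l | Split k l => (0 < k)%N && (0 < l)%N end.

Definition web : choiceType := seq (seq nat * vertex * seq nat).

Definition is_web (w : web) (a b : seq nat) : bool :=
  [&& is_word vsrc vtgt w a b, all (leq 1) a
    & all (fun sl => vertex_pos sl.1.2) w].

(* An edge labelled 0 is erased, so a vertex with such an edge is a plain strand;
   this occurs in the square relation when k = 1 or l = 1. *)
Definition strand (k : nat) : seq nat := if k == 0 then [::] else [:: k].
Definition merge_at (s : seq nat) (k l : nat) (t : seq nat) : web :=
  if (k == 0) || (l == 0) then [::] else [:: (s, Merge k l, t)].
Definition split_at (s : seq nat) (k l : nat) (t : seq nat) : web :=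
  if (k == 0) || (l == 0) then [::] else [:: (s, Split k l, t)].

(* (k, l) -> (k - 1, l + 1), for k > 0, and (k, l) -> (k + 1, l - 1), for l > 0 *)
Definition rung_right (k l : nat) : web :=
  split_at [::] k.-1 1 (strand l) ++ merge_at (strand k.-1) 1 l [::].
Definition rung_left (k l : nat) : web :=
  split_at (strand k) 1 l.-1 [::] ++ merge_at [::] k 1 (strand l.-1).

(* web_null a b r: r = 0 is one of the defining relations between webs from a
   to b.  Planar isotopies of upward-directed webs are the exchanges of the
   heights of two distant vertices. *)
Inductive web_null : seq nat -> seq nat -> {malg Zq[web]} -> Prop :=
| Null_isotopy g m h : vertex_pos g -> vertex_pos h ->
    web_null (vsrc g ++ m ++ vsrc h) (vtgt g ++ m ++ vtgt h)
      (<< (left_first vsrc vtgt g m h : web) >>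
       - << (right_first vsrc vtgt g m h : web) >>)
| Null_assoc k l p : (0 < k)%N -> (0 < l)%N -> (0 < p)%N ->
    web_null [:: k; l; p] [:: (k + l + p)%N]
      (<< ([:: ([::], Merge k l, [:: p]); ([::], Merge (k + l) p, [::])] : web) >>
       - << ([:: ([:: k], Merge l p, [::]); ([::], Merge k (l + p), [::])] : web) >>)
| Null_coassoc k l p : (0 < k)%N -> (0 < l)%N -> (0 < p)%N ->
    web_null [:: (k + l + p)%N] [:: k; l; p]
      (<< ([:: ([::], Split (k + l) p, [::]); ([::], Split k l, [:: p])] : web) >>
       - << ([:: ([::], Split k (l + p), [::]); ([:: k], Split l p, [::])] : web) >>)
| Null_digon k l : (0 < k)%N -> (0 < l)%N ->
    web_null [:: (k + l)%N] [:: (k + l)%N]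
      (<< ([:: ([::], Split k l, [::]); ([::], Merge k l, [::])] : web) >>
       - qbin (k + l) l *: << ([::] : web) >>)
| Null_square k l : (0 < k)%N -> (0 < l)%N ->
    web_null [:: k; l] [:: k; l]
      (<< (rung_right k l ++ rung_left k.-1 l.+1 : web) >>
       - << (rung_left k l ++ rung_right k.+1 l.-1 : web) >>
       - qint (k%:Z - l%:Z) *: << ([::] : web) >>).

(* (a, w) is the annular closure of the web w from a to a. *)
Definition annular_web : choiceType := (seq nat * web)%type.

Inductive annular_null : {malg Zq[annular_web]} -> Prop :=
| ANull_zero : annular_null 0
| ANull_lin c x y :
    annular_null x -> annular_null y -> annular_null (c *: x + y)
| ANull_rotate a b u v : is_web u a b -> is_web v b a ->
    annular_null (<< ((a, u ++ v) : annular_web) >>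
                  - << ((b, v ++ u) : annular_web) >>)
| ANull_local a b c s t u v r : web_null b c r ->
    is_web u a (s ++ b ++ t) -> is_web v (s ++ c ++ t) a ->
    annular_null
      (lin (fun w : web => << ((a, u ++ whisker s w t ++ v) : annular_web) >>) r).

Definition annular_eq (x y : {malg Zq[annular_web]}) : Prop :=
  annular_null (x - y).

(* Braids on m + 1 strands as words, read from bottom to top, in the letters
   (e, i): a crossing, positive iff e, of the strands in positions i and i + 1
   (counted from 0). *)

Definition braid (m : nat) : Type := seq (bool * 'I_m).

Definition writhe m (beta : braid m) : int :=
  \sum_(x <- beta) (if x.1 then 1 else -1).

Definition dumbbell m (i : 'I_m) : web :=
  [:: (nseq i 1, Merge 1 1, nseq (m - i.+1) 1);
      (nseq i 1, Split 1 1, nseq (m - i.+1) 1)]%N.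

Fixpoint bracket m (beta : braid m) : {malg Zq[web]} :=
  if beta is (e, i) :: beta' then
    (if e then - qpow 1 else - qpow (-1)) *: bracket beta'
    + lin (fun w : web => << (dumbbell i ++ w : web) >>) (bracket beta')
  else << ([::] : web) >>.

Definition closed_bracket m (beta : braid m) : {malg Zq[annular_web]} :=
  lin (fun w : web => << ((nseq m.+1 1%N, w) : annular_web) >>) (bracket beta).

(* A collection of concentric essential circles is the sequence of its labels,
   in radial order; it is the annular closure of vertical strands. *)
Definition circles : choiceType := seq nat.

Definition circles_web (x : {malg Zq[circles]}) : {malg Zq[annular_web]} :=
  lin (fun s : circles => << ((s, [::]) : annular_web) >>) x.

(* x is the expression of the closed bracket of beta in terms of circles with
   radially non-decreasing labels. *)
Definition annular_evaluation m (beta : braid m) (x : {malg Zq[circles]}) : Prop :=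
  {in msupp x, forall s : circles, all (leq 1) s && sorted leq s} /\
  annular_eq (closed_bracket beta) (circles_web x).

Definition eval_circles (A : comNzRingType) (f : Zq -> A) (c : nat -> A)
    (x : {malg Zq[circles]}) : A :=
  \sum_(s <- msupp x) f x@_s * \prod_(k <- s) c k.

(* Oriented link diagrams in generic (Morse) position.  A strand is labelled
   true if it is directed upward, and false otherwise.  In Cross o x y the
   strand x goes between bottom left and top right, the strand y between bottom
   right and top left, and x is the over-strand iff o. *)

Inductive tangle := Cup of bool | Cap of bool | Cross of bool & bool & bool.

Definition tsrc (g : tangle) : seq bool :=
  match g with
  | Cup _ => [::] | Cap x => [:: x; ~~ x] | Cross _ x y => [:: x; y]
  end.
Definition ttgt (g : tangle) : seq bool :=
  match g with
  | Cup x => [:: x; ~~ x] | Cap _ => [::] | Cross _ x y => [:: y; x]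
  end.

Definition tword : Type := seq (seq bool * tangle * seq bool).

Record link_diagram :=
  LinkDiagram { link_word :> tword; _ : is_word tsrc ttgt link_word [::] [::] }.

(* The local moves generating isotopy of links: planar isotopies (Move_isotopy
   to Move_slide_cup) and the Reidemeister moves, with all orientations.  In
   Move_R3, the condition excludes the cyclic configurations, where the three
   strands are not at three different heights. *)
Inductive tangle_move : tword -> tword -> Prop :=
| Move_isotopy g m h :
    tangle_move (left_first tsrc ttgt g m h) (right_first tsrc ttgt g m h)
| Move_zigzag_left x :
    tangle_move [:: ([:: x], Cup (~~ x), [::]); ([::], Cap x, [:: x])] [::]
| Move_zigzag_right x :
    tangle_move [:: ([::], Cup x, [:: x]); ([:: x], Cap (~~ x), [::])] [::]
| Move_slide_cap o x y :
    tangle_move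
      [:: ([:: y], Cross o x (~~ y), [::]); ([::], Cap y, [:: x])]
      [:: ([::], Cross (~~ o) y x, [:: ~~ y]); ([:: x], Cap y, [::])]
| Move_slide_cup o x y :
    tangle_move
      [:: ([::], Cup y, [:: x]); ([:: y], Cross o (~~ y) x, [::])]
      [:: ([:: x], Cup y, [::]); ([::], Cross (~~ o) x y, [:: ~~ y])]
| Move_R1_right o x :
    tangle_move
      [:: ([:: x], Cup x, [::]); ([::], Cross o x x, [:: ~~ x]);
          ([:: x], Cap x, [::])]
      [::]
| Move_R1_left o x :
    tangle_move
      [:: ([::], Cup (~~ x), [:: x]); ([:: ~~ x], Cross o x x, [::]);
          ([::], Cap (~~ x), [:: x])]
      [::]
| Move_R2 o x y :
    tangle_move [:: ([::], Cross o x y, [::]); ([::], Cross (~~ o) y x, [::])] [::]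
| Move_R3 o1 o2 o3 x y z : (o1 == o3) ==> (o2 == o1) ->
    tangle_move
      [:: ([::], Cross o1 x y, [:: z]); ([:: y], Cross o2 x z, [::]);
          ([::], Cross o3 y z, [:: x])]
      [:: ([:: x], Cross o3 y z, [::]); ([::], Cross o2 x z, [:: y]);
          ([:: z], Cross o1 x y, [::])].

Definition link_move (L L' : link_diagram) : Prop :=
  exists (u v : tword) (s t : seq bool) (w w' : tword),
    [/\ tangle_move w w', L = u ++ whisker s w t ++ v :> tword
      & L' = u ++ whisker s w' t ++ v :> tword].

Definition link_invariant (A : Type) (P : link_diagram -> A) : Prop :=
  forall L L', link_move L L' -> P L = P L'.

(* Any crossing is turned into an upward-directed one by a planar isotopy. *)
Definition skein_triple (Lp Lm L0 : link_diagram) : Prop :=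
  exists (u v : tword) (s t : seq bool),
    [/\ Lp = u ++ (s, Cross true true true, t) :: v :> tword,
        Lm = u ++ (s, Cross false true true, t) :: v :> tword
      & L0 = u ++ v :> tword].

Definition unknot : link_diagram :=
  @LinkDiagram [:: ([::], Cup true, [::]); ([::], Cap true, [::])] isT.

(* The strands of a braid are closed to its right. *)

Definition cups (m : nat) : tword :=
  [seq (nseq i true, Cup true, nseq i false) | i <- iota 0 m].
Definition caps (m : nat) : tword :=
  [seq (nseq i true, Cap true, nseq i false) | i <- rev (iota 0 m)].
Definition braid_word m (beta : braid m) : tword :=
  [seq (nseq x.2 true, Cross x.1 true true,
        nseq (m - x.2.+1) true ++ nseq m.+1 false) | x : bool * 'I_m <- beta].

Lemma nseq_recr (T : Type) (x : T) n s : nseq n x ++ x :: s = nseq n.+1 x ++ s.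
Proof. by elim: n => //= n ->. Qed.

Fact cups_word m : is_word tsrc ttgt (cups m) [::] (nseq m true ++ nseq m false).
Proof.
elim: m => [|m IHm] //; rewrite /cups -addn1 iotaD map_cat.
apply: is_word_cat IHm _; rewrite /= eqxx /=.
by rewrite nseq_recr addn1.
Qed.

Fact caps_word m : is_word tsrc ttgt (caps m) (nseq m true ++ nseq m false) [::].
Proof.
elim: m => [|m IHm] //; rewrite /caps -addn1 iotaD rev_cat map_cat /=.
by rewrite nseq_recr addn1 eqxx.
Qed.

Fact braid_wordP m (beta : braid m) (a := nseq m.+1 true ++ nseq m.+1 false) :
  is_word tsrc ttgt (braid_word beta) a a.
Proof.
elim: beta => [|[e i] beta IHbeta] /=; first by rewrite eqxx.
suff E : a = nseq i true ++ [:: true, true & nseq (m - i.+1) true ++ nseq m.+1 false].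
  by rewrite -E eqxx.
rewrite !nseq_recr catA -nseqD /a; congr (nseq _ _ ++ _).
by rewrite addSn addSn -addSn subnKC.
Qed.

Fact braid_closure_word m (beta : braid m) :
  is_word tsrc ttgt (cups m.+1 ++ braid_word beta ++ caps m.+1) [::] [::].
Proof.
apply: is_word_cat (cups_word _) _.
by apply: is_word_cat (braid_wordP _) (caps_word _).
Qed.

Definition braid_closure m (beta : braid m) : link_diagram :=
  LinkDiagram (braid_closure_word beta).

Definition sln_polynomial (n : nat) (P : link_diagram -> Zq) : Prop :=
  [/\ link_invariant P,
      forall Lp Lm L0, skein_triple Lp Lm L0 ->
        qpow (- n%:Z) * P Lp - qpow n%:Z * P Lm = (qpow (-1) - qpow 1) * P L0
    & P unknot = qint n%:Z].

Definition Qqa : fieldType := {fraction {poly Qq}}.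
Definition Zq_Qqa (z : Zq) : Qqa := tofrac (Zq_val z)%:P.
Definition qK : Qqa := Zq_Qqa (qpow 1).
Definition aK : Qqa := tofrac ('X : {poly Qq}).

Definition HOMFLYPT_polynomial (P : link_diagram -> Qqa) : Prop :=
  [/\ link_invariant P,
      forall Lp Lm L0, skein_triple Lp Lm L0 ->
        aK^-1 * P Lp - aK * P Lm = (qK^-1 - qK) * P L0
    & P unknot = (aK - aK^-1) / (qK - qK^-1)].

Definition cSym (k : nat) : Qqa :=
  qK ^+ k * aK ^- k *
  \prod_(1 <= i < k.+1) ((1 - aK ^+ 2 * qK ^+ (2 * i - 2)) / (1 - qK ^+ (2 * i))).

(* Main.v *)
From HB Require Import structures.
Require Import Defs.
From mathcomp Require Import all_boot all_order all_algebra.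
From mathcomp Require Import boolp functions finmap monalg.
From mathcomp Require Import zify ring.

Set Implicit Arguments.
Unset Strict Implicit.
Unset Printing Implicit Defensive.

Import GRing.Theory.
Local Open Scope ring_scope.

(** Both parts are instances of one statement, [braid_closure_value].  Let [F]
    be a field with an embedding of Q(q), let [a] be an element of [F] other
    than 0, 1 and -1, and let [P] be a link invariant with
    a^-1 P(L_+) - a P(L_-) = (q^-1 - q) P(L_0) and value
    c_1 = (a - a^-1) / (q - q^-1) on the unknot.  Part (1) is the case a = q^n,
    and in part (2) [a] is a formal variable.

    The idea is to let [P] itself play the role of the Markov trace.  On a
    positive braid word [w] on N strands, put
    tau(w) = a^-|w| P(closure of w) / c_1^N.  By the skein relation and
    stabilization ([closure_value_stabilize]) this does not depend on N, and by
    the Reidemeister moves and the skein relation tau satisfies, in every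
    context, the relations of the Hecke algebra with generators
    E_i = sigma_i + q.  Pulling a crossing around the closing strands
    ([closure_value_rotate]) gives tau(xy) = tau(yx) ([trace_comm]), and
    stabilization gives tau(x E_n) = (a^-1 / c_1 + q) tau(x) when [x] involves
    only the strands 0, ..., n ([trace_markov_gen]).

    Webs are represented in the Hecke algebra: an edge labelled k stands for
    the symmetrizer e_k, a merge (k, l) -> k + l for e_(k+l), and a split for
    its multiple by the quantum binomial coefficient.  Since a symmetrizer
    absorbs the symmetrizers on fewer of its strands, all defining relations but
    the square relation are immediate.  The square relation follows from the
    two recursions
      [k+1] e_(k+1) = [k] e_k E e_k - [k-1] e_k
    that add a strand on the right of e_k, or on the left ([projE] and
    [projE_left]): both of its terms become multiples of
    (e_k e_l) E (e_k e_l), and these cancel ([proj_square]).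

    Hence tau gives every closed web a value compatible with all annular
    relations ([annular_value_null]).  The value of the bracket of a braid is
    a^-writhe times [P], because -q Id + E is sigma and E - q^-1 Id is its
    inverse ([closed_bracket_value]).  The value of a collection of circles is
    computed by removing one strand at a time: the recursion for e_(k+1) and
    the Markov property give the ratio of the values of a (k+1)-labelled and of
    a k-labelled circle ([trace_proj]).  Comparing the two values proves the
    statement. *)

(** * Words of slices *)

Section WordLemmas.
Variables (X : eqType) (G : Type) (src tgt : G -> seq X).
Implicit Types (a b c s t : seq X) (w : seq (seq X * G * seq X)).
Local Notation is_word := (is_word src tgt).

Lemma is_word_whisker s t w a b :
  is_word w a b -> is_word (whisker s w t) (s ++ a ++ t) (s ++ b ++ t).
Proof.
elim: w a => [|[[s' g] t'] w IHw] a /=; first by move/eqP->.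
by case/andP=> /eqP-> /IHw; rewrite -!catA eqxx.
Qed.

Lemma whisker_cat s t w1 w2 :
  whisker s (w1 ++ w2) t = whisker s w1 t ++ whisker s w2 t.
Proof. exact: map_cat. Qed.

Lemma whisker_whisker s t s' t' w :
  whisker s (whisker s' w t') t = whisker (s ++ s') w (t' ++ t).
Proof.
rewrite /whisker -map_comp; apply: eq_map => -[[u g] v] /=.
by rewrite !catA.
Qed.

Lemma whisker0 w : whisker [::] w [::] = w.
Proof. by rewrite /whisker -[RHS]map_id; apply: eq_map => -[[u g] v]; rewrite /= cats0. Qed.

End WordLemmas.

(** * Local moves on link diagrams *)

Section LocalMoves.
Variables (A : Type) (P : link_diagram -> A) (d : A).
Hypothesis invP : link_invariant P.

Local Notation is_tangle := (is_word tsrc ttgt).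
Implicit Types (a b c s t : seq bool) (u v w : tword).

(** A total extension of [P] to words of slices, so that diagrams can be
    rewritten without carrying along the proofs that they are closed. *)
Definition word_value (w : tword) : A :=
  if @idP (is_tangle w [::] [::]) is ReflectT h then P (LinkDiagram h) else d.

Lemma word_valueE w (h : is_tangle w [::] [::]) :
  word_value w = P (LinkDiagram h).
Proof.
rewrite /word_value; case: {-}_ / idP => [h'|]; last by case.
by congr (P (LinkDiagram _)); apply: bool_irrelevance.
Qed.

(** [w] and [w'], both from [a] to [b], can be exchanged inside any closed
    diagram without changing the value of the invariant.  The boundary is part
    of the relation because one side of several moves is the empty word, which
    is well formed on every boundary, whereas the other side is not. *)
Definition interchangeable a b (w w' : tword) : Prop :=
  [/\ is_tangle w a b, is_tangle w' a b
    & forall s t u v, is_tangle u [::] (s ++ a ++ t) ->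
        is_tangle v (s ++ b ++ t) [::] ->
        word_value (u ++ whisker s w t ++ v)
          = word_value (u ++ whisker s w' t ++ v)].

Lemma interchangeable_move a b w w' :
  tangle_move w w' -> is_tangle w a b -> is_tangle w' a b ->
  interchangeable a b w w'.
Proof.
move=> mv h h'; split=> // s t u v hu hv.
have wd w1 : is_tangle w1 a b -> is_tangle (u ++ whisker s w1 t ++ v) [::] [::].
  move=> h1; apply: is_word_cat hu _.
  exact: is_word_cat (is_word_whisker _ _ h1) hv.
rewrite (word_valueE (wd _ h)) (word_valueE (wd _ h')); apply: invP.
by exists u, v, s, t, w, w'.
Qed.

Lemma interchangeable_refl a b w : is_tangle w a b -> interchangeable a b w w.
Proof. by split. Qed.

Lemma interchangeable_sym a b w w' :
  interchangeable a b w w' -> interchangeable a b w' w.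
Proof. by case=> h h' H; split=> // *; rewrite H. Qed.

Lemma interchangeable_trans w2 a b w1 w3 :
  interchangeable a b w1 w2 -> interchangeable a b w2 w3 ->
  interchangeable a b w1 w3.
Proof. by case=> h1 h2 H [_ h3 H']; split=> // *; rewrite H // H'. Qed.

Lemma interchangeable_cat b a c w1 w1' w2 w2' :
  interchangeable a b w1 w1' -> interchangeable b c w2 w2' ->
  interchangeable a c (w1 ++ w2) (w1' ++ w2').
Proof.
case=> h1 h1' H1 [h2 h2' H2].
split; [exact: is_word_cat h1 h2 | exact: is_word_cat h1' h2' |].
move=> s t u v hu hv; rewrite !whisker_cat -!catA H1 //; last first.
  exact: is_word_cat (is_word_whisker _ _ h2) hv.
rewrite !(catA u) H2 //.
exact: is_word_cat hu (is_word_whisker _ _ h1').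
Qed.

Lemma interchangeable_whisker s t a b w w' :
  interchangeable a b w w' ->
  interchangeable (s ++ a ++ t) (s ++ b ++ t) (whisker s w t) (whisker s w' t).
Proof.
case=> h h' H; split; try exact: is_word_whisker.
move=> s' t' u v hu hv; rewrite !whisker_whisker H //.
  by rewrite -!catA in hu *.
by rewrite -!catA in hv *.
Qed.

Lemma interchangeable_closed w w' :
  interchangeable [::] [::] w w' -> word_value w = word_value w'.
Proof.
by case=> _ _ /(_ [::] [::] [::] [::] isT isT); rewrite /= !cats0 !whisker0.
Qed.

(** Planar isotopy in the form in which it is used: the left piece [g] moves
    from below the right piece [h] to above it. *)
Lemma interchangeable_slide a b s g m h t s2 t1 s2' t1' :
  s2 = s ++ ttgt g ++ m -> t1 = m ++ tsrc h ++ t ->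
  s2' = s ++ tsrc g ++ m -> t1' = m ++ ttgt h ++ t ->
  a = s ++ tsrc g ++ m ++ tsrc h ++ t -> b = s ++ ttgt g ++ m ++ ttgt h ++ t ->
  interchangeable a b [:: (s, g, t1); (s2, h, t)] [:: (s2', h, t); (s, g, t1')].
Proof.
move=> -> -> -> -> -> ->.
have := @interchangeable_move (tsrc g ++ m ++ tsrc h) (ttgt g ++ m ++ ttgt h) _ _
  (Move_isotopy g m h).
rewrite /= !cats0 -!catA !eqxx /= => /(_ isT isT).
by move/(interchangeable_whisker s t); rewrite /whisker /= cats0 -!catA.
Qed.

End LocalMoves.

(** * Closures of braid words *)

Lemma nseq_recl (T : Type) (x : T) n : x :: nseq n x = nseq n.+1 x.
Proof. by []. Qed.

Lemma cat_nseq2 (T : Type) (x : T) n s : nseq n x ++ [:: x, x & s] = nseq n.+2 x ++ s.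
Proof. by rewrite !nseq_recr. Qed.

Lemma cat_nseqD (T : Type) (x : T) n p s :
  nseq n x ++ nseq p x ++ s = nseq (n + p) x ++ s.
Proof. by rewrite catA nseqD. Qed.

Lemma cat_nseq_sub (T : Type) (x : T) n i : (i.+1 < n)%N ->
  nseq (n - i.+2) x ++ [:: x, x & nseq i x] = nseq n x.
Proof.
move=> lt_in; rewrite !nseq_recl -nseqD; congr nseq.
exact: subnK.
Qed.

Lemma cat_nseq_subl (T : Type) (x : T) n i s : (i.+1 < n)%N ->
  nseq i x ++ [:: x, x & nseq (n - i.+2) x ++ s] = nseq n x ++ s.
Proof.
move=> lt_in; rewrite -[X in _ = nseq X _ ++ _](subnKC lt_in).
by rewrite cat_nseq2 nseqD catA.
Qed.

Lemma cat_nseq_subl0 (T : Type) (x : T) n i : (i.+1 < n)%N ->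
  nseq i x ++ [:: x, x & nseq (n - i.+2) x] = nseq n x.
Proof. by move=> lt_in; have := cat_nseq_subl x [::] lt_in; rewrite !cats0. Qed.

Section BraidClosures.
Variables (A : Type) (P : link_diagram -> A) (d : A).
Hypothesis invP : link_invariant P.

Local Notation is_tangle := (is_word tsrc ttgt).
Local Notation interchangeable := (interchangeable P d).
Implicit Types (w u v : seq (bool * nat)).

(** The strands of a closure in the middle of the diagram: those of the braid,
    and their returns. *)
Definition strands (N : nat) : seq bool := nseq N true ++ nseq N false.
Definition cup (i : nat) : seq bool * tangle * seq bool :=
  (nseq i true, Cup true, nseq i false).
Definition cap (i : nat) : seq bool * tangle * seq bool :=
  (nseq i true, Cap true, nseq i false).

Definition crossing (N : nat) (x : bool * nat) : seq bool * tangle * seq bool :=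
  (nseq x.2 true, Cross x.1 true true, nseq (N - x.2.+2) true ++ nseq N false).

(** The returns of the strands [i] and [i.+1] cross: this is what a positive
    crossing becomes when it is pulled around the closing arcs, which exchanges
    bottom and top, and left and right. *)
Definition return_crossing (N i : nat) : seq bool * tangle * seq bool :=
  (nseq N true ++ nseq (N - i.+2) false, Cross true false false, nseq i false).

Definition crossings (N : nat) (w : seq (bool * nat)) : tword :=
  map (crossing N) w.
Definition closure_word (N : nat) (w : seq (bool * nat)) : tword :=
  cups N ++ crossings N w ++ caps N.

Definition on_strands (N : nat) (w : seq (bool * nat)) : bool :=
  all (fun x => x.2.+1 < N)%N w.

Lemma cupsS N : cups N.+1 = cups N ++ [:: cup N].
Proof. by rewrite /cups -addn1 iotaD map_cat. Qed.

Lemma capsS N : caps N.+1 = cap N :: caps N.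
Proof. by rewrite /caps -addn1 iotaD rev_cat map_cat. Qed.

Lemma crossing_word N x :
  (x.2.+1 < N)%N -> is_tangle [:: crossing N x] (strands N) (strands N).
Proof.
case: x => e i /= lt_iN; rewrite /crossing /strands /=.
by rewrite !cat_nseq2 !cat_nseqD subnKC // !eqxx.
Qed.

Lemma crossings_word N w :
  on_strands N w -> is_tangle (crossings N w) (strands N) (strands N).
Proof.
elim: w => [|x w IHw] /=; first by rewrite eqxx.
by case/andP=> hx /IHw; apply: is_word_cat (crossing_word hx).
Qed.

Lemma return_crossing_word N i :
  (i.+1 < N)%N -> is_tangle [:: return_crossing N i] (strands N) (strands N).
Proof.
move=> lt_iN; rewrite /return_crossing /strands /= -!catA /=.
by rewrite cat_nseq_sub // !eqxx.
Qed.

(** The crossing is pulled over the inner cup, which turns it into a crossing of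
    a downward and an upward strand between two cups placed side by side, and
    then over the other cup. *)
Lemma nested_cups_crossing :
  interchangeable [::] (strands 2)
    [:: cup 0; cup 1; ([::], Cross true true true, [:: false; false])]
    [:: cup 0; cup 1; ([:: true; true], Cross true false false, [::])].
Proof.
pose mid : seq bool * tangle * seq bool :=
  ([:: true], Cross false false true, [:: false]).
apply: (@interchangeable_trans _ _ _ [:: cup 0; ([::], Cup true, [:: true; false]); mid]).
  apply: (interchangeable_cat (w1 := [:: cup 0]) (w1' := [:: cup 0]) (b := strands 1)).
    exact: interchangeable_refl.
  have := interchangeable_move d invP (Move_slide_cup false true true).
  move/(_ [:: true] [:: true; true; false] isT isT).
  by move/(interchangeable_whisker [::] [:: false]) => H; exact: interchangeable_sym H.
apply: (@interchangeable_trans _ _ _ [:: cup 0; ([:: true; false], Cup true, [::]); mid]).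
  apply: (interchangeable_cat (b := [:: true; false; true; false])
    (w1 := [:: cup 0; ([::], Cup true, [:: true; false])])
    (w1' := [:: cup 0; ([:: true; false], Cup true, [::])])).
    apply: interchangeable_sym.
    by apply: (interchangeable_move d invP (Move_isotopy (Cup true) [::] (Cup true))).
  exact: interchangeable_refl.
apply: (interchangeable_cat (w1 := [:: cup 0]) (w1' := [:: cup 0]) (b := strands 1)).
  exact: interchangeable_refl.
have := interchangeable_move d invP (Move_slide_cup true false true).
move/(_ [:: false] [:: true; false; false] isT isT).
by move/(interchangeable_whisker [:: true] [::]) => H; exact: interchangeable_sym H.
Qed.

(** The mirror image of [nested_cups_crossing]. *)
Lemma nested_caps_crossing :
  interchangeable (strands 2) [::]
    [:: ([::], Cross true true true, [:: false; false]); cap 1; cap 0]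
    [:: ([:: true; true], Cross true false false, [::]); cap 1; cap 0].
Proof.
pose mid : seq bool * tangle * seq bool :=
  ([:: true], Cross false true false, [:: false]).
apply: (@interchangeable_trans _ _ _ [:: mid; ([::], Cap true, [:: true; false]); cap 0]).
  apply: (interchangeable_cat (w2 := [:: cap 0]) (w2' := [:: cap 0])
    (w1 := [:: ([::], Cross true true true, [:: false; false]); cap 1])
    (w1' := [:: mid; ([::], Cap true, [:: true; false])])
    (b := [:: true; false])).
    have := interchangeable_move d invP (Move_slide_cap false true true).
    move/(_ [:: true; true; false] [:: true] isT isT).
    by move/(interchangeable_whisker [::] [:: false]) => H; exact: interchangeable_sym H.
  exact: interchangeable_refl.
apply: (@interchangeable_trans _ _ _ [:: mid; ([:: true; false], Cap true, [::]); cap 0]).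
  apply: (interchangeable_cat (w1 := [:: mid]) (w1' := [:: mid])
     (b := [:: true; false; true; false])).
    exact: interchangeable_refl.
  by apply: (interchangeable_move d invP (Move_isotopy (Cap true) [::] (Cap true))).
apply: (interchangeable_cat (w2 := [:: cap 0]) (w2' := [:: cap 0])
    (w1 := [:: mid; ([:: true; false], Cap true, [::])])
    (w1' := [:: ([:: true; true], Cross true false false, [::]); cap 1])
    (b := [:: true; false])).
  have := interchangeable_move d invP (Move_slide_cap true false true).
  move/(_ [:: true; false; false] [:: false] isT isT).
  by move/(interchangeable_whisker [:: true] [::]) => H; exact: interchangeable_sym H.
exact: interchangeable_refl.
Qed.

Lemma cup_word N : is_tangle [:: cup N] (strands N) (strands N.+1).
Proof. by rewrite /= /strands eqxx /= nseq_recr. Qed.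

Lemma cap_word N : is_tangle [:: cap N] (strands N.+1) (strands N).
Proof. by rewrite /= /strands eqxx /= nseq_recr eqxx. Qed.

Lemma slide_crossing_cup N x : (x.2.+1 < N)%N ->
  interchangeable (strands N) (strands N.+1)
    [:: crossing N x; cup N] [:: cup N; crossing N.+1 x].
Proof.
case: x => e i /= lt_iN.
have E1 : nseq (N.+1 - i.+2) true = true :: nseq (N - i.+2) true by rewrite subSn.
have E := (fun s => cat_nseq_subl true s lt_iN, cat_nseq_subl0 true lt_iN).
apply: (@interchangeable_slide _ P d invP _ _ (nseq i true) (Cross e true true)
  (nseq (N - i.+2) true) (Cup true) (nseq N false));
by rewrite ?E1 /strands /= ?E ?nseq_recr.
Qed.

Lemma slide_cap_crossing N x : (x.2.+1 < N)%N ->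
  interchangeable (strands N.+1) (strands N)
    [:: cap N; crossing N x] [:: crossing N.+1 x; cap N].
Proof.
case: x => e i /= lt_iN; apply: interchangeable_sym.
have E1 : nseq (N.+1 - i.+2) true = true :: nseq (N - i.+2) true by rewrite subSn.
have E := (fun s => cat_nseq_subl true s lt_iN, cat_nseq_subl0 true lt_iN).
apply: (@interchangeable_slide _ P d invP _ _ (nseq i true) (Cross e true true)
  (nseq (N - i.+2) true) (Cap true) (nseq N false));
by rewrite ?E1 /strands /= ?E ?nseq_recr.
Qed.

Lemma slide_cup_return N i : (i.+1 < N)%N ->
  interchangeable (strands N) (strands N.+1)
    [:: cup N; return_crossing N.+1 i] [:: return_crossing N i; cup N].
Proof.
move=> lt_iN.
have E1 : nseq (N.+1 - i.+2) false = false :: nseq (N - i.+2) false by rewrite subSn.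
apply: (@interchangeable_slide _ P d invP _ _ (nseq N true) (Cup true)
  (nseq (N - i.+2) false) (Cross true false false) (nseq i false));
by rewrite ?E1 /strands /= ?(cat_nseq_sub false lt_iN) ?nseq_recr.
Qed.

Lemma slide_cap_return N i : (i.+1 < N)%N ->
  interchangeable (strands N.+1) (strands N)
    [:: cap N; return_crossing N i] [:: return_crossing N.+1 i; cap N].
Proof.
move=> lt_iN.
have E1 : nseq (N.+1 - i.+2) false = false :: nseq (N - i.+2) false by rewrite subSn.
apply: (@interchangeable_slide _ P d invP _ _ (nseq N true) (Cap true)
  (nseq (N - i.+2) false) (Cross true false false) (nseq i false));
by rewrite ?E1 /strands /= ?(cat_nseq_sub false lt_iN) ?nseq_recr.
Qed.

Lemma slide_crossing_return N x i : (x.2.+1 < N)%N -> (i.+1 < N)%N ->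
  interchangeable (strands N) (strands N)
    [:: crossing N x; return_crossing N i] [:: return_crossing N i; crossing N x].
Proof.
case: x => e j /= lt_jN lt_iN.
have E := (fun s => cat_nseq_subl true s lt_jN, cat_nseq_sub false lt_iN).
apply: (@interchangeable_slide _ P d invP _ _ (nseq j true) (Cross e true true)
  (nseq (N - j.+2) true ++ nseq (N - i.+2) false) (Cross true false false) (nseq i false));
by rewrite /strands /= -?catA /= ?E.
Qed.

(** The cups nested inside the two that meet the crossing do not interact with
    it: both forms of the crossing slide below them. *)
Lemma cups_crossing N i : (i.+1 < N)%N ->
  interchangeable [::] (strands N)
    (cups N ++ [:: crossing N (true, i)]) (cups N ++ [:: return_crossing N i]).
Proof.
elim: N => // N IHN; rewrite ltnS leq_eqVlt => /predU1P[{IHN}<-|lt_iN].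
  rewrite !cupsS -!catA.
  apply: interchangeable_cat (interchangeable_refl _ _ (cups_word i)) _.
  have := interchangeable_whisker (nseq i true) (nseq i false) nested_cups_crossing.
  rewrite /whisker /= /cup /crossing /return_crossing /= !subnn /=.
  by rewrite !cats0 /strands !cat_nseq2 !(nseq_recr _ _ [::]) !cats0.
rewrite cupsS -!catA.
apply: (@interchangeable_trans _ _ _ ((cups N ++ [:: crossing N (true, i)]) ++ [:: cup N])).
  rewrite -catA; apply: interchangeable_cat (interchangeable_refl _ _ (cups_word N)) _.
  by apply: interchangeable_sym; apply: slide_crossing_cup.
apply: (@interchangeable_trans _ _ _ ((cups N ++ [:: return_crossing N i]) ++ [:: cup N])).
  apply: interchangeable_cat (IHN lt_iN) _.
  exact: interchangeable_refl (cup_word N).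
rewrite -catA; apply: interchangeable_cat (interchangeable_refl _ _ (cups_word N)) _.
by apply: interchangeable_sym; apply: slide_cup_return.
Qed.

Lemma caps_crossing N i : (i.+1 < N)%N ->
  interchangeable (strands N) [::]
    (crossing N (true, i) :: caps N) (return_crossing N i :: caps N).
Proof.
elim: N => // N IHN; rewrite ltnS leq_eqVlt => /predU1P[{IHN}<-|lt_iN].
  rewrite !capsS.
  apply: (interchangeable_cat (w1 := [:: _; _; _]) (w1' := [:: _; _; _])
    _ (interchangeable_refl _ _ (caps_word i))).
  have := interchangeable_whisker (nseq i true) (nseq i false) nested_caps_crossing.
  rewrite /whisker /= /cap /crossing /return_crossing /= !subnn /=.
  by rewrite !cats0 /strands !cat_nseq2 !(nseq_recr _ _ [::]) !cats0.
rewrite capsS.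
apply: (@interchangeable_trans _ _ _ ([:: cap N] ++ crossing N (true, i) :: caps N)).
  apply: (interchangeable_cat (w1 := [:: _; _]) (w1' := [:: _; _])
    _ (interchangeable_refl _ _ (caps_word N))).
  by apply: interchangeable_sym; apply: slide_cap_crossing.
apply: (@interchangeable_trans _ _ _ ([:: cap N] ++ return_crossing N i :: caps N)).
  apply: interchangeable_cat (IHN lt_iN).
  exact: interchangeable_refl (cap_word N).
apply: (interchangeable_cat (w1 := [:: _; _]) (w1' := [:: _; _])
    _ (interchangeable_refl _ _ (caps_word N))).
by apply: slide_cap_return.
Qed.

Definition closure_value N w : A := word_value P d (closure_word N w).

Lemma closure_wordP N w :
  on_strands N w -> is_tangle (closure_word N w) [::] [::].
Proof.
move=> hw; apply: is_word_cat (cups_word _) _.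
exact: is_word_cat (crossings_word hw) (caps_word _).
Qed.

Lemma closure_value_local N u v w w' :
  interchangeable (strands N) (strands N) (crossings N w) (crossings N w') ->
  on_strands N u -> on_strands N v ->
  closure_value N (u ++ w ++ v) = closure_value N (u ++ w' ++ v).
Proof.
case=> _ _ /(_ [::] [::] (cups N ++ crossings N u) (crossings N v ++ caps N)).
rewrite !whisker0 /closure_value /closure_word /crossings !map_cat -!catA /= cats0.
move=> H hu hv; apply: H.
  exact: is_word_cat (cups_word _) (crossings_word hu).
exact: is_word_cat (crossings_word hv) (caps_word _).
Qed.

Lemma closure_value_R2 N u v e i :
  on_strands N u -> on_strands N v -> (i.+1 < N)%N ->
  closure_value N (u ++ [:: (e, i), (~~ e, i) & v]) = closure_value N (u ++ v).
Proof.
move=> hu hv lt_iN.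
apply: (closure_value_local (w := [:: (e, i); (~~ e, i)]) (w' := [::])) => //.
have := interchangeable_move d invP (Move_R2 e true true).
move/(_ [:: true; true] [:: true; true] isT isT).
move/(interchangeable_whisker (nseq i true) (nseq (N - i.+2) true ++ nseq N false)).
by rewrite /whisker /= /strands (cat_nseq_subl true _ lt_iN) cats0.
Qed.

Lemma closure_value_R3 N u v i :
  on_strands N u -> on_strands N v -> (i.+2 < N)%N ->
  closure_value N (u ++ [:: (true, i), (true, i.+1), (true, i) & v])
    = closure_value N (u ++ [:: (true, i.+1), (true, i), (true, i.+1) & v]).
Proof.
move=> hu hv lt_iN.
apply: (closure_value_local (w := [:: (true, i); (true, i.+1); (true, i)])
                       (w' := [:: (true, i.+1); (true, i); (true, i.+1)])) => //.
have := interchangeable_move d invP (@Move_R3 true true true true true true isT).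
move/(_ [:: true; true; true] [:: true; true; true] isT isT).
move/(interchangeable_whisker (nseq i true) (nseq (N - i.+3) true ++ nseq N false)).
rewrite /whisker /= /strands !(nseq_recr _ _ [::]) !cats0.
have E1 : nseq (N - i.+2) true = true :: nseq (N - i.+3) true.
  by rewrite -[X in nseq X true = _]prednK ?subn_gt0 // -subnS.
rewrite [nseq i true ++ [:: _, _, _ & _]](_ : _ = strands N); last first.
  by rewrite /strands -(cat_nseq_subl true _ (ltnW lt_iN)) E1.
by rewrite /crossings /crossing /= E1.
Qed.

Lemma closure_value_far N u v e e' i j :
  on_strands N u -> on_strands N v -> (i.+1 < j)%N -> (j.+1 < N)%N ->
  closure_value N (u ++ [:: (e, i), (e', j) & v])
    = closure_value N (u ++ [:: (e', j), (e, i) & v]).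
Proof.
move=> hu hv lt_ij lt_jN.
apply: (closure_value_local (w := [:: (e, i); (e', j)]) (w' := [:: (e', j); (e, i)])) => //.
have E1 : nseq (N - i.+2) true = nseq (j - i.+2) true ++ [:: true, true & nseq (N - j.+2) true].
  rewrite cat_nseq2 -nseqD; congr nseq; lia.
have E2 := cat_nseq_subl0 true lt_ij.
have E3 := cat_nseq_subl true (nseq N false) (leq_trans lt_ij (ltnW (ltnW lt_jN))).
rewrite E1 -catA /= in E3.
by apply: (@interchangeable_slide _ P d invP _ _ (nseq i true) (Cross e true true)
  (nseq (j - i.+2) true) (Cross e' true true) (nseq (N - j.+2) true ++ nseq N false));
  rewrite /= ?E1 ?E2 -?catA /= ?E3.
Qed.

(** The first crossing of the braid is pulled around the cups to the returning
    strands, slides up past the rest of the braid, and is pulled back around the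
    caps. *)
Lemma closure_value_rotate N w i :
  on_strands N w -> (i.+1 < N)%N ->
  closure_value N ((true, i) :: w) = closure_value N (rcons w (true, i)).
Proof.
move=> hw lt_iN; apply: interchangeable_closed.
rewrite /closure_word /crossings map_rcons -cats1 -!catA.
apply: (@interchangeable_trans _ _ _
  ((cups N ++ [:: return_crossing N i]) ++ crossings N w ++ caps N)).
  rewrite -[map _ (_ :: _)]cat1s -catA catA; apply: interchangeable_cat (cups_crossing lt_iN) _.
  apply: interchangeable_refl.
  exact: is_word_cat (crossings_word hw) (caps_word _).
apply: (@interchangeable_trans _ _ _
  (cups N ++ (crossings N w ++ [:: return_crossing N i]) ++ caps N)); last first.
  apply: interchangeable_cat (interchangeable_refl _ _ (cups_word _)) _.
  rewrite -catA; apply: interchangeable_cat (interchangeable_refl _ _ (crossings_word hw)) _.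
  exact: interchangeable_sym (caps_crossing lt_iN).
rewrite -catA; apply: interchangeable_cat (interchangeable_refl _ _ (cups_word _)) _.
rewrite catA; apply: interchangeable_cat (interchangeable_refl _ _ (caps_word _)).
elim: w hw => [|x w IHw] /=.
  by move=> _; exact: interchangeable_refl (return_crossing_word lt_iN).
case/andP=> hx hw; have {}IHw := IHw hw.
apply: (@interchangeable_trans _ _ _ ([:: crossing N x] ++ return_crossing N i :: crossings N w)).
  apply: (interchangeable_cat (w1 := [:: _; _]) (w1' := [:: _; _]) _
    (interchangeable_refl _ _ (crossings_word hw))).
  by apply: interchangeable_sym; apply: slide_crossing_return.
exact: (interchangeable_cat (interchangeable_refl _ _ (crossing_word hx)) IHw).
Qed.

Lemma slide_cup_crossings N w : on_strands N w ->
  interchangeable (strands N) (strands N.+1)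
    (cup N :: crossings N.+1 w) (crossings N w ++ [:: cup N]).
Proof.
elim: w => [_|x w IHw] /=; first exact: interchangeable_refl (cup_word N).
case/andP=> hx hw.
apply: (@interchangeable_trans _ _ _ ([:: crossing N x] ++ cup N :: crossings N.+1 w)).
  apply: (interchangeable_cat (w1 := [:: _; _]) (w1' := [:: _; _]) (b := strands N.+1)).
    by apply: interchangeable_sym; apply: slide_crossing_cup.
  apply: interchangeable_refl; apply: crossings_word.
  by apply: sub_all hw => y /ltnW.
exact: (interchangeable_cat (interchangeable_refl _ _ (crossing_word hx)) (IHw hw)).
Qed.

(** The innermost cup is lifted to the top of the braid, where it forms a curl
    with the last crossing and the innermost cap. *)
Lemma closure_value_stabilize n w e :
  on_strands n.+1 w ->
  closure_value n.+2 (rcons w (e, n)) = closure_value n.+1 w.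
Proof.
move=> hw; apply: interchangeable_closed.
rewrite /closure_word cupsS capsS /crossings map_rcons -cats1 -!catA.
apply: interchangeable_cat (interchangeable_refl _ _ (cups_word _)) _.
apply: (@interchangeable_trans _ _ _ ((crossings n.+1 w ++ [:: cup n.+1]) ++
  [:: crossing n.+2 (e, n), cap n.+1 & caps n.+1])).
  apply: (interchangeable_cat (w1 := _ :: _) (slide_cup_crossings hw)).
  apply: interchangeable_refl.
  apply: is_word_cat (is_word_cat (_ : is_tangle [:: crossing n.+2 (e, n)] _ _)
    (cap_word n.+1)) (caps_word _).
  exact: crossing_word.
rewrite -catA; apply: interchangeable_cat (interchangeable_refl _ _ (crossings_word hw)) _.
apply: (interchangeable_cat (w1 := [:: _; _; _]) (w1' := [::])
    _ (interchangeable_refl _ _ (caps_word _))).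
have := interchangeable_move d invP (Move_R1_right e true).
move/(_ [:: true] [:: true] isT isT).
move/(interchangeable_whisker (nseq n true) (nseq n.+1 false)).
by rewrite /whisker /crossing /= subnn !(nseq_recr _ _ [::]) !nseq_recr !cats0.
Qed.

End BraidClosures.

(** * Functions on positive braid words satisfying the Hecke relations *)

Section HeckeFunctions.
Variables (F : fieldType) (q : F).
Implicit Types (u v w : seq nat) (i j k o : nat).

(** The functions on the free monoid on the sigma_i that factor through the Hecke
    algebra, that is, the linear forms on the Hecke algebra with
    sigma^2 = (q^-1 - q) sigma + 1. *)
Definition hecke_closed : {pred (seq nat -> F^o)} := fun f : seq nat -> F =>
  `[< [/\ forall u v i,
            f (u ++ [:: i, i & v]) = (q^-1 - q) * f (u ++ i :: v) + f (u ++ v),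
          forall u v i j, (i.+1 < j)%N ->
            f (u ++ [:: i, j & v]) = f (u ++ [:: j, i & v])
        & forall u v i,
            f (u ++ [:: i, i.+1, i & v]) = f (u ++ [:: i.+1, i, i.+1 & v])] >].

Fact hecke_closed_submod : submod_closed hecke_closed.
Proof.
split=> [|c f g /asboolP[f1 f2 f3] /asboolP[g1 g2 g3]]; apply/asboolP; split=> //.
- by move=> u v i; rewrite mulr0 addr0.
- by move=> u v i; rewrite !fctE f1 g1 /GRing.scale /=; ring.
- by move=> u v i j lt_ij; rewrite !fctE f2 // g2.
- by move=> u v i; rewrite !fctE f3 g3.
Qed.

HB.instance Definition _ :=
  GRing.isSubmodClosed.Build F (seq nat -> F^o) hecke_closed hecke_closed_submod.

Record hecke_fun :=
  HeckeFun { hecke_val : seq nat -> F^o; _ : hecke_val \in hecke_closed }.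
HB.instance Definition _ := [isSub for hecke_val].
HB.instance Definition _ := [Choice of hecke_fun by <:].
HB.instance Definition _ := [SubChoice_isSubLmodule of hecke_fun by <:].
Definition hecke_app (f : hecke_fun) : seq nat -> F := hecke_val f.
Coercion hecke_app : hecke_fun >-> Funclass.
#[global] Arguments hecke_app : simpl never.
Implicit Types (f g : hecke_fun).

Lemma hecke_funP f g : (forall w, f w = g w) -> f = g.
Proof. by move=> fg; apply: val_inj; apply: funext. Qed.

Lemma hecke_funD f g w : (f + g) w = f w + g w. Proof. by []. Qed.
Lemma hecke_funN f w : (- f) w = - f w. Proof. by []. Qed.
Lemma hecke_funZ c f w : (c *: f) w = c * f w. Proof. by []. Qed.

Fact shift_subproof i f : (fun w => f (rcons w i)) \in hecke_closed.
Proof.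
case: f => f hf; rewrite /hecke_app /=.
case/asboolP: hf => f1 f2 f3; apply/asboolP; split=> u v *.
- by rewrite !rcons_cat f1.
- by rewrite !rcons_cat f2.
- by rewrite !rcons_cat f3.
Qed.
Definition shift i f : hecke_fun := HeckeFun (shift_subproof i f).

Lemma shiftE i f w : shift i f w = f (rcons w i). Proof. by []. Qed.
Definition hecke_funE := (hecke_funD, hecke_funN, hecke_funZ, shiftE).

(** Expressions for elements of the Hecke algebra.  The algebra itself is only
    seen through its faithful action on [hecke_fun] by right translation, so that
    equations between elements are equations between the functions [act x f]. *)
Inductive hecke :=
  HOne | HGen of nat | HMul of hecke & hecke | HAdd of hecke & hecke
| HScale of F & hecke.
Implicit Types (x y : hecke).

(** [HGen i] is E_i = sigma_i + q, the web 1,1 -> 2 -> 1,1. *)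
Fixpoint act x f : hecke_fun :=
  match x with
  | HOne => f
  | HGen i => shift i f + q *: f
  | HMul x y => act x (act y f)
  | HAdd x y => act x f + act y f
  | HScale c x => c *: act x f
  end.

Fact act_is_linear x : linear (act x).
Proof.
move=> c f g; elim: x f g => [|i|x IHx y IHy|x IHx y IHy|b x IHx] f g //=.
- by apply: hecke_funP => w; rewrite !hecke_funE; ring.
- by rewrite IHy IHx.
- by rewrite IHy IHx scalerDr addrACA.
- by rewrite IHx scalerDr !scalerA mulrC.
Qed.
HB.instance Definition _ x :=
  GRing.isLinear.Build F hecke_fun hecke_fun _ (act x) (act_is_linear x).

#[global] Arguments act : simpl never.

Lemma act1 f : act HOne f = f. Proof. by []. Qed.
Lemma actM x y f : act (HMul x y) f = act x (act y f). Proof. by []. Qed.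
Lemma actD x y f : act (HAdd x y) f = act x f + act y f. Proof. by []. Qed.
Lemma actZ c x f : act (HScale c x) f = c *: act x f. Proof. by []. Qed.

Lemma act_genE i f w : act (HGen i) f w = f (rcons w i) + q * f w.
Proof. by []. Qed.

Hypothesis q_neq0 : q != 0.

Lemma hecke_quad f u i :
  f (rcons (rcons u i) i) = (q^-1 - q) * f (rcons u i) + f u.
Proof.
case: f => f hf; rewrite /hecke_app /=.
case/asboolP: hf => f1 _ _; have := f1 u [::] i.
by rewrite -!cat_rcons !cats0.
Qed.

Lemma hecke_far f u i j : (i.+1 < j)%N ->
  f (rcons (rcons u i) j) = f (rcons (rcons u j) i).
Proof.
case: f => f hf; rewrite /hecke_app /=.
case/asboolP: hf => _ f2 _ lt_ij; have := f2 u [::] i j lt_ij.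
by rewrite -!cat_rcons !cats0.
Qed.

Lemma hecke_braid f u i :
  f (rcons (rcons (rcons u i) i.+1) i) = f (rcons (rcons (rcons u i.+1) i) i.+1).
Proof.
case: f => f hf; rewrite /hecke_app /=.
case/asboolP: hf => _ _ f3; have := f3 u [::] i.
by rewrite -!cat_rcons !cats0.
Qed.

Lemma act_gen_quad i f :
  act (HGen i) (act (HGen i) f) = (q + q^-1) *: act (HGen i) f.
Proof.
by apply: hecke_funP => w; rewrite !(act_genE, hecke_funE) hecke_quad; field.
Qed.

Lemma act_gen_far i j f : (i.+1 < j)%N ->
  act (HGen i) (act (HGen j) f) = act (HGen j) (act (HGen i) f).
Proof.
move=> lt_ij; apply: hecke_funP => w.
by rewrite !(act_genE, hecke_funE) hecke_far //; ring.
Qed.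

Lemma act_gen_braid i f :
  act (HGen i) (act (HGen i.+1) (act (HGen i) f)) - act (HGen i) f =
  act (HGen i.+1) (act (HGen i) (act (HGen i.+1) f)) - act (HGen i.+1) f.
Proof.
apply: hecke_funP => w.
by rewrite !(act_genE, hecke_funE) !hecke_quad hecke_braid; field.
Qed.

Lemma scalerC (c d : F) f : c *: (d *: f) = d *: (c *: f).
Proof. by rewrite !scalerA mulrC. Qed.

Definition qnum (n : nat) : F := (q ^+ n - q ^- n) / (q - q^-1).
Hypothesis qnumS_neq0 : forall n, qnum n.+1 != 0.
Local Notation q2 := (q + q^-1).

Lemma qden_neq0 : q - q^-1 != 0.
Proof. by apply: contraNneq (qnumS_neq0 0) => e; rewrite /qnum e invr0 mulr0. Qed.

Lemma qnum0 : qnum 0 = 0.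
Proof. by rewrite /qnum expr0 invr1 subrr mul0r. Qed.

Lemma qnum1 : qnum 1 = 1.
Proof. by rewrite /qnum expr1 divff ?qden_neq0. Qed.

Lemma qnumSS n : qnum n.+2 = q2 * qnum n.+1 - qnum n.
Proof.
rewrite /qnum mulrA -mulrBl !exprS; congr (_ / _); field.
by rewrite q_neq0 expf_neq0.
Qed.

(** [x] is an expression on the strands [lo], ..., [hi.-1]; the generator [i]
    involves the strands [i] and [i.+1]. *)
Fixpoint supported (lo hi : nat) x : bool :=
  match x with
  | HOne => true
  | HGen i => (lo <= i) && (i.+1 < hi)
  | HMul x y | HAdd x y => supported lo hi x && supported lo hi y
  | HScale _ x => supported lo hi x
  end%N.

Lemma supported_sub lo hi lo' hi' x :
  (lo' <= lo)%N -> (hi <= hi')%N -> supported lo hi x -> supported lo' hi' x.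
Proof.
move=> le_lo le_hi; elim: x => //= [i|x IHx y IHy|x IHx y IHy].
- by case/andP=> /(leq_trans le_lo)-> /leq_trans->.
- by case/andP=> /IHx-> /IHy.
- by case/andP=> /IHx-> /IHy.
Qed.

Lemma act_far lo hi lo' hi' x y f :
  supported lo hi x -> supported lo' hi' y -> (hi <= lo')%N ->
  act x (act y f) = act y (act x f).
Proof.
move=> sx sy le_hl; elim: x sx f => [|i|x IHx z IHz|x IHx z IHz|c x IHx] sx f //.
- case/andP: sx => _ lt_ih; elim: y sy f => [|j|y IHy z IHz|y IHy z IHz|c y IHy] sy f //.
  + by apply: act_gen_far; case/andP: sy => ? _; lia.
  + by case/andP: sy => sy sz; rewrite !actM (IHy sy) (IHz sz).
  + case/andP: sy => sy sz; rewrite !actD linearD /=.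
    by rewrite (IHy sy) (IHz sz).
  + by rewrite !actZ linearZ /= IHy.
- by case/andP: sx => sx sz; rewrite !actM (IHz sz) (IHx sx).
- by case/andP: sx => sx sz; rewrite !actD linearD /= (IHz sz) (IHx sx).
- by rewrite !actZ linearZ /= IHx.
Qed.

(** * Symmetrizers *)

(** The one-dimensional representation of the Hecke algebra in which every
    sigma_i acts by q^-1; the symmetrizers are its idempotents. *)
Fixpoint trivial_char x : F :=
  match x with
  | HOne => 1
  | HGen _ => q2
  | HMul x y => trivial_char x * trivial_char y
  | HAdd x y => trivial_char x + trivial_char y
  | HScale c x => c * trivial_char x
  end.

Lemma act_trivial lo hi f x :
  (forall i, (lo <= i)%N -> (i.+1 < hi)%N -> act (HGen i) f = q2 *: f) ->
  supported lo hi x -> act x f = trivial_char x *: f.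
Proof.
move=> fgen; elim: x => [|i|x IHx y IHy|x IHx y IHy|c x IHx] /=.
- by rewrite act1 scale1r.
- by case/andP; apply: fgen.
- by case/andP=> /IHx{}IHx /IHy{}IHy; rewrite actM IHy linearZ /= IHx scalerA mulrC.
- by case/andP=> /IHx{}IHx /IHy{}IHy; rewrite actD IHx IHy scalerDl.
- by move/IHx=> {}IHx; rewrite actZ IHx scalerA.
Qed.

Lemma trivial_act lo hi (p : {linear hecke_fun -> hecke_fun}) x f :
  (forall i g, (lo <= i)%N -> (i.+1 < hi)%N -> p (act (HGen i) g) = q2 *: p g) ->
  supported lo hi x -> p (act x f) = trivial_char x *: p f.
Proof.
move=> pgen; elim: x f => [|i|x IHx y IHy|x IHx y IHy|c x IHx] f /=.
- by rewrite act1 scale1r.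
- by case/andP; apply: pgen.
- by case/andP=> sx sy; rewrite actM IHx // IHy // scalerA.
- by case/andP=> sx sy; rewrite actD linearD /= IHx // IHy // scalerDl.
- by move=> sx; rewrite actZ linearZ /= IHx // scalerA.
Qed.

(** The inductive step for the absorption of generators by symmetrizers.  Here
    [p] and [r] are the symmetrizers on k and k - 1 strands, [G] is the last
    generator that [p] involves, [E] the next one, and the scalars are [k],
    [k-1], [k-2] and [2].  Expanding the first [p] of E p E p by the recursion
    makes E G E appear, to which the braid relation applies. *)
Lemma projector_left_step (p r E G : {linear hecke_fun -> hecke_fun}) (a b c d : F) :
  (forall f, a *: p f = b *: r (G (r f)) - c *: r f) ->
  (forall f, E (r f) = r (E f)) -> (forall f, r (p f) = p f) ->
  (forall f, G (p f) = d *: p f) -> (forall f, E (E f) = d *: E f) ->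
  (forall f, E (G (E f)) - E f = G (E (G f)) - G f) ->
  forall f, E (a *: p (E (p f)) - b *: p f) = d *: (a *: p (E (p f)) - b *: p f).
Proof.
move=> hp Er rp Gp EE braid f; rewrite !hp; set g := p f.
have rg : r g = g by rewrite rp.
have Gg : G g = d *: g by rewrite Gp.
have EGE : E (G (E g)) = E g + (d *: G (E g) - d *: g).
  have := braid g; rewrite Gg !linearZ /= => /eqP.
  by rewrite subr_eq => /eqP->; rewrite addrC.
have rEg : r (E g) = E g by rewrite -Er rg.
rewrite linearB linearB /= !linearZ /=.
rewrite rEg Er EGE EE !linearD !linearN !linearZ /= rEg rg.
by apply: hecke_funP => w; rewrite !hecke_funE; ring.
Qed.

(** The same computation with all products reversed. *)
Lemma projector_right_step (p r E G : {linear hecke_fun -> hecke_fun}) (a b c d : F) :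
  (forall f, a *: p f = b *: r (G (r f)) - c *: r f) ->
  (forall f, E (r f) = r (E f)) -> (forall f, p (r f) = p f) ->
  (forall f, p (G f) = d *: p f) -> (forall f, E (E f) = d *: E f) ->
  (forall f, E (G (E f)) - E f = G (E (G f)) - G f) ->
  forall f, a *: p (E (p (E f))) - b *: p (E f) = d *: (a *: p (E (p f)) - b *: p f).
Proof.
move=> hp Er pr pG EE braid f.
have EGE g : E (G (E g)) = E g + G (E (G g)) - G g.
  by rewrite -addrA -braid addrC subrK.
have -> g : a *: p (E (p g)) = p (E (a *: p g)) by rewrite !linearZ.
have -> : a *: p (E (p f)) = p (E (a *: p f)) by rewrite !linearZ.
rewrite !hp !linearB /= !linearZ /= !Er !pr -Er EGE EE !linearB !linearD /= !linearZ /= !pG.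
rewrite Er !pr.
by apply: hecke_funP => w; rewrite !hecke_funE; ring.
Qed.

(** The symmetrizer e_k on the strands [o], ..., [o + k - 1]. *)
Fixpoint proj k o : hecke :=
  if k isn't k'.+1 then HOne else
  if k' isn't k''.+1 then HOne else
  HAdd (HScale (qnum k' / qnum k) (HMul (proj k' o) (HMul (HGen (o + k'')) (proj k' o))))
       (HScale (- (qnum k'' / qnum k)) (proj k' o)).

Lemma projE k o f (p := act (proj k.+1 o)) :
  qnum k.+2 *: act (proj k.+2 o) f
    = qnum k.+1 *: p (act (HGen (o + k)) (p f)) - qnum k *: p f.
Proof.
rewrite [proj k.+2 o]/= !actD !actZ !actM scalerDr !scalerA -scaleNr.
have cancel z : qnum k.+2 * (z / qnum k.+2) = z by rewrite mulrC divfK.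
by rewrite mulrN !cancel.
Qed.

Lemma proj_supported k o : supported o (o + k) (proj k o).
Proof.
elim: k => // -[|k] IHk //=.
have /= -> : supported o (o + k.+2) (proj k.+1 o).
  by apply: supported_sub IHk; rewrite ?leq_add2l.
by rewrite leq_addr addnS addnS ltnSn.
Qed.

Lemma trivial_char_proj k o : trivial_char (proj k o) = 1.
Proof.
elim: k => // -[|k] // IHk; rewrite [proj _ _]/=.
rewrite /trivial_char -/trivial_char IHk; apply: (mulIf (qnumS_neq0 k.+1)).
by rewrite [RHS]mul1r [RHS]qnumSS; field; rewrite q_neq0 qnumS_neq0.
Qed.

#[global] Arguments proj : simpl never.
Lemma proj0 o : proj 0 o = HOne. Proof. by []. Qed.
Lemma proj1 o : proj 1 o = HOne. Proof. by []. Qed.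
Lemma qnum_proj2 o f : qnum 2 *: act (proj 2 o) f = act (HGen o) f.
Proof. by rewrite projE qnum0 scale0r subr0 qnum1 scale1r addn0. Qed.

(** By induction on [k]: the last generator is the subject of the two steps above,
    and the others are absorbed by the smaller symmetrizers from which [proj k o]
    is built. *)
Lemma proj_gen k o i f : (o <= i)%N -> (i.+1 < o + k)%N ->
  act (HGen i) (act (proj k o) f) = q2 *: act (proj k o) f /\
  act (proj k o) (act (HGen i) f) = q2 *: act (proj k o) f.
Proof.
elim/ltn_ind: k o i f => k IH o i f le_oi lt_ik.
have charL j x g : (j < k)%N -> supported o (o + j) x ->
    act x (act (proj j o) g) = trivial_char x *: act (proj j o) g.
  by move=> lt_jk; apply: act_trivial => l h1 h2; case: (IH _ lt_jk o l g h1 h2).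
have charR j x g : (j < k)%N -> supported o (o + j) x ->
    act (proj j o) (act x g) = trivial_char x *: act (proj j o) g.
  by move=> lt_jk; apply: trivial_act => l h h1 h2; case: (IH _ lt_jk o l h h1 h2).
case: k IH lt_ik charL charR => [|[|k]] IH lt_ik charL charR; try lia.
have inj_q g h : qnum k.+2 *: g = qnum k.+2 *: h -> g = h.
  by move/(scalerI (qnumS_neq0 _)).
have [sE|->] : supported o (o + k.+1) (HGen i) \/ i = (o + k)%N.
  by rewrite /=; lia.
  have pL g : act (HGen i) (act (proj k.+1 o) g) = q2 *: act (proj k.+1 o) g.
    exact: charL.
  have pR g : act (proj k.+1 o) (act (HGen i) g) = q2 *: act (proj k.+1 o) g.
    exact: charR.
  split; apply: inj_q.
    rewrite -[LHS]linearZ /= [RHS]scalerC !projE.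
    rewrite linearB !linearZ /= !pL.
    by apply: hecke_funP => w; rewrite !hecke_funE; ring.
  rewrite [RHS]scalerC !projE !pR !linearZ /=.
  by apply: hecke_funP => w; rewrite !hecke_funE; ring.
case: k IH lt_ik charL charR inj_q => [|k] IH lt_ik charL charR inj_q.
  rewrite addn0; split; apply: inj_q; rewrite [RHS]scalerC !qnum_proj2 ?act_gen_quad //.
  by rewrite -[LHS]linearZ /= !qnum_proj2 act_gen_quad.
have hp g : qnum k.+2 *: act (proj k.+2 o) g =
    qnum k.+1 *: act (proj k.+1 o) (act (HGen (o + k)) (act (proj k.+1 o) g))
    - qnum k *: act (proj k.+1 o) g by exact: projE.
have Er g : act (HGen (o + k.+1)) (act (proj k.+1 o) g)
          = act (proj k.+1 o) (act (HGen (o + k.+1)) g).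
  symmetry.
  apply: (act_far (lo' := (o + k.+1)%N) (hi' := (o + k.+3)%N) g
    (proj_supported k.+1 o)) => //=.
  by lia.
have sr : supported o (o + k.+2) (proj k.+1 o).
  by apply: supported_sub (proj_supported k.+1 o); rewrite ?leq_add2l.
have rp g : act (proj k.+1 o) (act (proj k.+2 o) g) = act (proj k.+2 o) g.
  by rewrite charL // trivial_char_proj scale1r.
have pr g : act (proj k.+2 o) (act (proj k.+1 o) g) = act (proj k.+2 o) g.
  by rewrite charR // trivial_char_proj scale1r.
have sG : supported o (o + k.+2) (HGen (o + k)).
  by rewrite /= leq_addr !addnS ltnSn.
have Gp g : act (HGen (o + k)) (act (proj k.+2 o) g) = q2 *: act (proj k.+2 o) g.
  exact: charL.
have pG g : act (proj k.+2 o) (act (HGen (o + k)) g) = q2 *: act (proj k.+2 o) g.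
  exact: charR.
have EGE g : act (HGen (o + k.+1)) (act (HGen (o + k)) (act (HGen (o + k.+1)) g))
      - act (HGen (o + k.+1)) g
    = act (HGen (o + k)) (act (HGen (o + k.+1)) (act (HGen (o + k)) g))
      - act (HGen (o + k)) g.
  by rewrite addnS -act_gen_braid.
have EE g : act (HGen (o + k.+1)) (act (HGen (o + k.+1)) g)
          = q2 *: act (HGen (o + k.+1)) g by exact: act_gen_quad.
split; apply: inj_q; rewrite [RHS]scalerC.
  rewrite -[LHS]linearZ /= (projE k.+1 o f).
  exact: (projector_left_step hp Er rp Gp EE EGE).
rewrite (projE k.+1 o f) (projE k.+1 o (act _ f)).
exact: (projector_right_step hp Er pr pG EE EGE).
Qed.

Lemma act_proj x k o f : supported o (o + k) x ->
  act x (act (proj k o) f) = trivial_char x *: act (proj k o) f.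
Proof. by apply: act_trivial => i h1 h2; case: (proj_gen f h1 h2). Qed.

Lemma proj_act x k o f : supported o (o + k) x ->
  act (proj k o) (act x f) = trivial_char x *: act (proj k o) f.
Proof. by apply: trivial_act => i g h1 h2; case: (proj_gen g h1 h2). Qed.

(** The mirror image of the recursion that defines [proj].  By the same inductive
    step its right hand side y satisfies E_i y = [2] y for all generators, and
    such an element is a multiple of the symmetrizer e: since e absorbs y on the
    one hand, and y absorbs e on the other, y = e y is the value of the trivial
    character on y times e. *)
Lemma projE_left k o f (p := act (proj k.+1 o.+1)) :
  qnum k.+2 *: act (proj k.+2 o) f
    = qnum k.+1 *: p (act (HGen o) (p f)) - qnum k *: p f.
Proof.
rewrite {}/p; elim: k o f => [|k IHk] o f.
  by rewrite qnum_proj2 proj1 !act1 qnum0 qnum1 scale0r subr0 scale1r.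
set p := proj k.+2 o.+1; set r := proj k.+1 o.+2.
pose y := HAdd (HScale (qnum k.+2) (HMul p (HMul (HGen o) p))) (HScale (- qnum k.+1) p).
have yE g : act y g = qnum k.+2 *: act p (act (HGen o) (act p g)) - qnum k.+1 *: act p g.
  by rewrite /y !actD !actZ !actM scaleNr.
rewrite -yE.
have sp : supported o (o + k.+3) p.
  by apply: supported_sub (proj_supported k.+2 o.+1); rewrite ?addSn ?addnS.
have sr : supported o.+1 (o.+1 + k.+2) r.
  by apply: supported_sub (proj_supported k.+1 o.+2); rewrite ?addSn ?addnS.
have pgen i g : (o < i)%N -> (i.+1 < o + k.+3)%N ->
    act (HGen i) (act p g) = q2 *: act p g.
  by move=> lt_oi lt_ik; case: (@proj_gen k.+2 o.+1 i g); rewrite ?addSnnS.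
have ygen i g : (o <= i)%N -> (i.+1 < o + k.+3)%N ->
    act (HGen i) (act y g) = q2 *: act y g.
  rewrite leq_eqVlt => /predU1P[<- _|lt_oi lt_ik]; rewrite yE; last first.
    rewrite linearB !linearZ /= !(pgen i) //.
    by apply: hecke_funP => w; rewrite !hecke_funE; ring.
  have hp h : qnum k.+2 *: act p h = qnum k.+1 *: act r (act (HGen o.+1) (act r h))
                                     - qnum k *: act r h by exact: IHk.
  have Er h : act (HGen o) (act r h) = act r (act (HGen o) h).
    apply: (act_far (lo := o) (hi := o.+2) h _ (proj_supported k.+1 o.+2)) => //=.
    by rewrite leqnn ltnSn.
  have rp h : act r (act p h) = act p h.
    by rewrite act_proj // trivial_char_proj scale1r.
  have Gp h : act (HGen o.+1) (act p h) = q2 *: act p h.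
    by apply: pgen => //; lia.
  have EE h := act_gen_quad o h.
  have EGE h := act_gen_braid o h.
  exact: (projector_left_step hp Er rp Gp EE EGE).
have yact x g : supported o (o + k.+3) x -> act x (act y g) = trivial_char x *: act y g.
  by apply: act_trivial => i; apply: ygen.
have sy : supported o (o + k.+3) y.
  by rewrite /y; move: (p) sp => p' /= ->; lia.
have cy : trivial_char y = qnum k.+3.
  have := trivial_char_proj k.+2 o.+1.
  by rewrite (qnumSS k.+1) /y -/p; move: (p) => p' /= ->; ring.
by rewrite -cy -(proj_act _ sy) yact ?proj_supported // trivial_char_proj scale1r.
Qed.

Lemma proj_idem k o f : act (proj k o) (act (proj k o) f) = act (proj k o) f.
Proof. by rewrite act_proj ?proj_supported // trivial_char_proj scale1r. Qed.

(** The square relation, between the symmetrizers on the first k+1 strands and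
    on the next l+1 strands.  A strand is added to the second one on its left,
    and to the first one on its right, by the same generator. *)
Lemma proj_square k l o f :
  (qnum k.+1 * qnum l.+2) *:
    act (proj k.+1 o) (act (proj l.+1 (o + k.+1))
      (act (proj l.+2 (o + k)) (act (proj k.+1 o) (act (proj l.+1 (o + k.+1)) f))))
  - (qnum l.+1 * qnum k.+2) *:
    act (proj k.+1 o) (act (proj l.+1 (o + k.+1))
      (act (proj k.+2 o) (act (proj k.+1 o) (act (proj l.+1 (o + k.+1)) f))))
  = (qnum l.+1 * qnum k - qnum k.+1 * qnum l) *:
    act (proj k.+1 o) (act (proj l.+1 (o + k.+1)) f).
Proof.
set a := proj k.+1 o; set b := proj l.+1 (o + k.+1).
have ab g : act a (act b g) = act b (act a g).
  exact: (act_far g (proj_supported k.+1 o) (proj_supported l.+1 (o + k.+1))).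
rewrite -(scalerA (qnum k.+1)) -(scalerA (qnum l.+1)).
have -> g : qnum l.+2 *: act a (act b (act (proj l.+2 (o + k)) g)) =
    act a (act b (qnum l.+2 *: act (proj l.+2 (o + k)) g)) by rewrite !linearZ.
have -> g : qnum k.+2 *: act a (act b (act (proj k.+2 o) g)) =
    act a (act b (qnum k.+2 *: act (proj k.+2 o) g)) by rewrite !linearZ.
rewrite projE_left projE -addnS -/a -/b.
have aa g : act a (act a g) = act a g by exact: proj_idem.
have bb g : act b (act b g) = act b g by exact: proj_idem.
have bab g : act b (act a (act b g)) = act a (act b g) by rewrite -ab bb.
have aba g : act a (act b (act a g)) = act a (act b g) by rewrite -ab aa.
rewrite !linearB !linearZ /= !linearZ /= !(aa, bb, bab, aba).
by apply: hecke_funP => w; rewrite !hecke_funE; ring.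
Qed.

End HeckeFunctions.

(** * The Markov trace given by a link invariant *)

Section LinkTrace.
Variables (F : fieldType) (q a : F).
Hypotheses (q_neq0 : q != 0) (qnumS_neq0 : forall n, qnum q n.+1 != 0).
Hypothesis a_neq0 : a != 0.

Definition circle1 : F := (a - a^-1) / (q - q^-1).
Hypothesis circle1_neq0 : circle1 != 0.

Variable P : link_diagram -> F.
Hypothesis invP : link_invariant P.
Hypothesis skeinP : forall Lp Lm L0, skein_triple Lp Lm L0 ->
  a^-1 * P Lp - a * P Lm = (q^-1 - q) * P L0.
Hypothesis unknotP : P unknot = circle1.

Implicit Types (w u v : seq nat) (s : seq nat) (b : seq (bool * nat)) (i j k o : nat).
Local Notation C := (closure_value P 0).
Let qden : q - q^-1 != 0. Proof. exact: qden_neq0 qnumS_neq0. Qed.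

Lemma on_strands_cat N b b' :
  on_strands N (b ++ b') = on_strands N b && on_strands N b'.
Proof. exact: all_cat. Qed.

Lemma closure_value_skein N b b' i :
  on_strands N b -> on_strands N b' -> (i.+1 < N)%N ->
  a^-1 * C N (b ++ (true, i) :: b') - a * C N (b ++ (false, i) :: b')
    = (q^-1 - q) * C N (b ++ b').
Proof.
move=> hb hb' lt_iN.
have h e : on_strands N (b ++ (e, i) :: b') by rewrite on_strands_cat hb /= lt_iN.
have h0 : on_strands N (b ++ b') by rewrite on_strands_cat hb.
rewrite /closure_value (word_valueE _ _ (closure_wordP (h true))).
rewrite (word_valueE _ _ (closure_wordP (h false))) (word_valueE _ _ (closure_wordP h0)).
apply: skeinP; exists (cups N ++ crossings N b), (crossings N b' ++ caps N).
exists (nseq i true), (nseq (N - i.+2) true ++ nseq N false).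
by split; rewrite /= /closure_word /crossings map_cat -!catA.
Qed.

(** A split strand contributes c_1: the skein relation is applied to the two
    stabilizations of the braid, by a positive and by a negative crossing. *)
Lemma closure_value_strand n b :
  on_strands n.+1 b -> C n.+2 b = circle1 * C n.+1 b.
Proof.
move=> hb; have hb' : on_strands n.+2 b by apply: sub_all hb => x /ltnW.
have := closure_value_skein hb' (isT : on_strands n.+2 [::]) (ltnSn _).
rewrite !cats1 !(closure_value_stabilize 0 invP _ hb) cats0 => E.
apply: (mulfI qden); rewrite -[LHS]opprK -mulNr opprB -E /circle1.
by rewrite mulrA [_ * (_ / _)]mulrC divfK //; ring.
Qed.

Definition positive w : seq (bool * nat) := [seq (true, i) | i <- w].
(** A number of strands that is sufficient for the letters of [w]; the choice does
    not affect the normalized value ([trace_valE]). *)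
Definition width w : nat := (foldr maxn 0 w).+2.

Lemma width_positive w : on_strands (width w) (positive w).
Proof.
rewrite /on_strands all_map; apply/allP => i /=; rewrite /width !ltnS.
elim: w => //= j w IHw; rewrite inE => /predU1P[->|/IHw]; first exact: leq_maxl.
by move/leq_trans; apply; apply: leq_maxr.
Qed.

Definition trace_val w : F :=
  a ^- size w * C (width w) (positive w) / circle1 ^+ width w.

Lemma trace_valE n w : on_strands n.+1 (positive w) ->
  trace_val w = a ^- size w * C n.+1 (positive w) / circle1 ^+ n.+1.
Proof.
move=> hw.
have stab p m : on_strands m.+1 (positive w) ->
    C (p + m.+1) (positive w) / circle1 ^+ (p + m.+1) = C m.+1 (positive w) / circle1 ^+ m.+1.
  move=> hm; elim: p => // p IHp; rewrite -IHp !addSn !addnS closure_value_strand.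
    by rewrite exprS invfM mulrACA divff // mul1r.
  by apply: sub_all hm => x; lia.
rewrite /trace_val -!mulrA; congr (_ * _).
case: (leqP n.+1 (width w)) => [le|/ltnW le]; rewrite -(subnK le).
  exact: stab.
symmetry; apply: stab; exact: width_positive.
Qed.

Lemma positive_cat w w' : positive (w ++ w') = positive w ++ positive w'.
Proof. exact: map_cat. Qed.

Lemma common_width w : exists n, on_strands n.+1 (positive w).
Proof. by exists (width w).-1; apply: width_positive. Qed.

(** The quadratic relation is the skein relation at one of two equal consecutive
    crossings, whose negative form cancels with the other one. *)
Fact trace_closed : trace_val \in hecke_closed q.
Proof.
apply/asboolP; split=> [u v i|u v i j lt_ij|u v i].
- have [n] := common_width (u ++ i :: v).
  rewrite positive_cat on_strands_cat /= => /and3P[hu hi hv].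
  rewrite !(@trace_valE n) ?positive_cat ?on_strands_cat /= ?hu ?hi ?hv //.
  have := closure_value_skein hu (b' := (true, i) :: positive v) _ hi.
  rewrite [on_strands _ _]/= hi hv (closure_value_R2 0 invP false hu hv hi) => /(_ isT).
  move/eqP; rewrite subr_eq => /eqP E.
  have -> : C n.+1 (positive u ++ [:: (true, i), (true, i) & positive v]) =
     a * ((q^-1 - q) * C n.+1 (positive u ++ (true, i) :: positive v)
          + a * C n.+1 (positive u ++ positive v)).
    by rewrite -E mulVKf.
  rewrite !size_cat /= !addnS !exprS; field.
  by rewrite a_neq0 q_neq0 circle1_neq0 !expf_neq0.
- have [n] := common_width (u ++ [:: i, j & v]).
  rewrite positive_cat on_strands_cat /= => /and4P[hu hi hj hv].
  rewrite !(@trace_valE n) ?positive_cat ?on_strands_cat /= ?hu ?hi ?hj ?hv //.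
  by rewrite (closure_value_far 0 invP _ _ hu hv) // !size_cat.
- have [n] := common_width (u ++ [:: i, i.+1 & v]).
  rewrite positive_cat on_strands_cat /= => /and4P[hu hi hj hv].
  rewrite !(@trace_valE n) ?positive_cat ?on_strands_cat /= ?hu ?hi ?hj ?hv //.
  by rewrite (closure_value_R3 0 invP hu hv) // !size_cat.
Qed.

Definition trace : hecke_fun q := HeckeFun trace_closed.

Lemma traceE w : trace w = trace_val w. Proof. by []. Qed.

Lemma trace_nil : trace [::] = 1.
Proof.
rewrite traceE (@trace_valE 0) //= expr0 invr1 mul1r expr1.
rewrite /closure_value (word_valueE _ _ (closure_wordP (isT : on_strands 1 [::]))).
have -> : LinkDiagram (closure_wordP (isT : on_strands 1 [::])) = unknot.
  by rewrite /unknot; congr LinkDiagram; apply: bool_irrelevance.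
by rewrite unknotP divff.
Qed.

Lemma trace_rot w i : trace (rcons w i) = trace (i :: w).
Proof.
have [n /andP[hi hw]] := common_width (i :: w).
rewrite !traceE !(@trace_valE n) ?size_rcons /positive ?map_rcons /on_strands ?all_rcons /= ?hi //.
by rewrite (closure_value_rotate 0 invP).
Qed.

Lemma trace_markov w i : all (fun j => j < i)%N w ->
  trace (rcons w i) = (a^-1 / circle1) * trace w.
Proof.
move=> hw.
have h1 : on_strands i.+1 (positive w) by rewrite /on_strands all_map.
have h2 : on_strands i.+2 (positive w) by apply: sub_all h1 => x /ltnW.
rewrite !traceE (trace_valE h1) (@trace_valE i.+1); last first.
  by rewrite /positive map_rcons /on_strands all_rcons /= ltnSn.
rewrite /positive map_rcons (closure_value_stabilize 0 invP) // size_rcons !exprS; field.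
by rewrite a_neq0 circle1_neq0 !expf_neq0.
Qed.

Implicit Types (x y : hecke F) (f g : hecke_fun q).

(** Right translations commute with left translations. *)
Lemma act_translate x u f g :
  (forall w, f w = g (u ++ w)) -> forall w, act x f w = act x g (u ++ w).
Proof.
elim: x f g => [|i|x IHx y IHy|x IHx y IHy|c x IHx] f g fg w.
- exact: fg.
- by rewrite !act_genE !fg rcons_cat.
- by rewrite !actM; apply: IHx => {}w; apply: IHy.
- by rewrite !actD !hecke_funE (IHx f g) // (IHy f g).
- by rewrite !actZ !hecke_funE (IHx f g).
Qed.

(** It is enough that [x] is a generator, and then [trace_rot] turns the right
    translation of [trace] by a letter into a left translation. *)
Lemma trace_comm x y : act x (act y trace) [::] = act y (act x trace) [::].
Proof.
elim: x y => [|i|x IHx z IHz|x IHx z IHz|c x IHx] y //.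
- have -> : act (HGen F i) trace = shift i trace + q *: trace by [].
  rewrite linearD linearZ /= act_genE !hecke_funE; congr (_ + _).
  rewrite -[rcons [::] i]/([:: i] ++ [::]); symmetry; apply: act_translate => w.
  by rewrite shiftE trace_rot.
- by rewrite actM -(actM z y) IHx actM -(actM y x) IHz !actM.
- by rewrite !actD !linearD /= !hecke_funE IHx IHz.
- by rewrite !actZ !linearZ /= !hecke_funE IHx.
Qed.

(** [act x] only uses the values on words in the letters that [x] involves. *)
Lemma act_agree n x f g : supported 0 n.+1 x ->
  (forall w, all (fun j => j < n)%N w -> f w = g w) ->
  forall w, all (fun j => j < n)%N w -> act x f w = act x g w.
Proof.
elim: x f g => [|i|x IHx y IHy|x IHx y IHy|c x IHx] f g /= sx fg w hw.
- exact: fg.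
- by rewrite !act_genE !fg // all_rcons hw andbT.
- by case/andP: sx => sx sy; rewrite !actM (IHx _ (act y g)) // => v hv; apply: IHy.
- by case/andP: sx => sx sy; rewrite !actD !hecke_funE (IHx f g) // (IHy f g).
- by rewrite !actZ !hecke_funE (IHx f g).
Qed.

Lemma trace_markov_gen n x : supported 0 n.+1 x ->
  act x (act (HGen F n) trace) [::] = (a^-1 / circle1 + q) * act x trace [::].
Proof.
move=> sx; rewrite -hecke_funZ -linearZ /=; apply: (act_agree sx) => // w hw.
by rewrite act_genE hecke_funZ trace_markov // mulrDl.
Qed.

(** The value of a k-labelled circle: the quantum binomial coefficient
    (n + k - 1 choose k) with q^n replaced by [a]. *)
Definition circle k : F :=
  \prod_(i < k) ((a * q ^+ i - (a * q ^+ i)^-1) / (q ^+ i.+1 - q ^- i.+1)).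

Lemma circle_1 : circle 1 = circle1.
Proof. by rewrite /circle big_ord1 expr0 mulr1 expr1. Qed.

(** Closing the last k strands.  By cyclicity e_(k+1) E e_(k+1) may be replaced
    with e_(k+1) E under the trace, and the Markov property removes E; the
    recursion for e_(k+2) thus yields the ratio of consecutive values. *)
Lemma trace_proj k o x : supported 0 o x ->
  circle1 ^+ k * act x (act (proj q k o) trace) [::] = circle k * act x trace [::].
Proof.
move=> sx; elim: k => [|[|k] IHk].
- by rewrite proj0 act1 expr0 /circle big_ord0.
- by rewrite proj1 act1 expr1 circle_1.
set e := proj q k.+1 o in IHk *.
have se : supported o (o + k.+1) e by apply: proj_supported.
have sxe : supported 0 (o + k).+1 (HMul x e).
  rewrite /= (supported_sub _ _ sx) //; last by lia.
  by rewrite (supported_sub _ _ se) // addnS.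
have cyc : act x (act e (act (HGen F (o + k)) (act e trace))) [::]
         = (a^-1 / circle1 + q) * act x (act e trace) [::].
  rewrite -[LHS]/(act (HMul x (HMul e (HGen F (o + k)))) (act e trace) [::]).
  rewrite trace_comm !actM -(act_far q_neq0 _ sx se (leqnn _)) proj_idem //.
  by rewrite -actM trace_markov_gen.
have := congr1 (fun f => act x f [::]) (projE qnumS_neq0 k o trace).
rewrite linearB !linearZ /= !hecke_funE -/e cyc => E.
have ratio : circle1 * (qnum q k.+1 * (a^-1 / circle1 + q) - qnum q k) =
   qnum q k.+2 * ((a * q ^+ k.+1 - (a * q ^+ k.+1)^-1) / (q ^+ k.+2 - q ^- k.+2)).
  have nz := qnumS_neq0 k.+1; rewrite {1}/qnum mulf_eq0 negb_or in nz.
  case/andP: nz => nz _.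
  rewrite [RHS]mulrC /qnum mulrA divfK // mulrBr mulrCA mulrDr.
  rewrite [circle1 * (_ / _)]mulrC divfK // /circle1 !exprS.
  have q2 : q * q - 1 != 0.
    by rewrite -(divff q_neq0) -mulrBr mulf_neq0.
  by field; rewrite q_neq0 q2 a_neq0 expf_neq0.
set r := _ / (_ - _) in ratio.
have -> : circle k.+2 = circle k.+1 * r by rewrite /circle big_ord_recr.
set d' := _ + q in ratio E.
apply: (mulfI (qnumS_neq0 k.+1)); rewrite mulrCA E.
transitivity (qnum q k.+2 * r * (circle k.+1 * act x trace [::])); last by ring.
by rewrite -ratio -IHk exprS; ring.
Qed.

(** The product of the symmetrizers of parallel edges labelled [s], the first of
    which starts at the strand [o]. *)
Fixpoint projs o s : hecke F :=
  if s is k :: s' then HMul (proj q k o) (projs (o + k) s') else HOne F.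

Lemma projs_supported o s : supported o (o + sumn s) (projs o s).
Proof.
elim: s o => //= k s IHs o; rewrite (supported_sub _ _ (proj_supported q k o)) //.
  by rewrite addnA (supported_sub _ _ (IHs (o + k)%N)) // leq_addr.
by rewrite leq_add2l leq_addr.
Qed.

Lemma trace_projs s :
  circle1 ^+ sumn s * act (projs 0 s) trace [::] = \prod_(k <- s) circle k.
Proof.
suff H o x : supported 0 o x ->
    circle1 ^+ sumn s * act x (act (projs o s) trace) [::]
      = \prod_(k <- s) circle k * act x trace [::].
  by have := H 0 (HOne F) isT; rewrite !act1 trace_nil mulr1.
elim: s o x => [|k s IHs] o x sx; first by rewrite big_nil expr0 !mul1r act1.
rewrite big_cons [projs _ _]/= [sumn _]/= actM exprD -mulrA.
have sxp : supported 0 (o + k) (HMul x (proj q k o)).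
  rewrite /= (supported_sub _ _ sx) ?leq_addr //.
  exact: supported_sub (proj_supported q k o).
rewrite -actM (IHs _ _ sxp) actM mulrCA trace_proj // mulrCA; ring.
Qed.

End LinkTrace.

(** * Linear extension to formal combinations *)

Section Extension.
Variables (F : fieldType) (phi : {rmorphism Zq -> F}) (V : lmodType F).

Definition extend (K : choiceType) (g : K -> V) (x : {malg Zq[K]}) : V :=
  \sum_(k <- msupp x) phi x@_k *: g k.

Lemma extendEw (K : choiceType) (g : K -> V) (D : {fset K}) x :
  (msupp x `<=` D)%fset -> extend g x = \sum_(k <- D) phi x@_k *: g k.
Proof.
move=> sD; rewrite /extend (big_fset_incl _ sD) // => k _ kx.
by rewrite mcoeff_outdom // rmorph0 scale0r.
Qed.

Lemma extend_lin (K : choiceType) (g : K -> V) c x y :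
  extend g (c *: x + y) = phi c *: extend g x + extend g y.
Proof.
pose D := (msupp x `|` msupp y)%fset.
have sx : (msupp x `<=` D)%fset by apply: fsubsetUl.
have sy : (msupp y `<=` D)%fset by apply: fsubsetUr.
have sxy : (msupp (c *: x + y) `<=` D)%fset.
  apply: fsubset_trans (msuppD_le _ _) _; rewrite fsubUset sy andbT.
  exact: fsubset_trans (msuppZ_le _ _) sx.
rewrite (extendEw _ sx) (extendEw _ sy) (extendEw _ sxy) scaler_sumr -big_split.
by apply: eq_bigr => k _; rewrite mcoeffD mcoeffZ rmorphD rmorphM scalerDl scalerA.
Qed.

Lemma extend0 (K : choiceType) (g : K -> V) : extend g 0 = 0.
Proof. by rewrite /extend msupp0 big_seq_fset0. Qed.

Lemma extendZ (K : choiceType) (g : K -> V) c x : extend g (c *: x) = phi c *: extend g x.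
Proof. by rewrite -[c *: x]addr0 extend_lin extend0 addr0. Qed.

Lemma extendB (K : choiceType) (g : K -> V) x y : extend g (x - y) = extend g x - extend g y.
Proof. by rewrite -(scaleN1r y) (addrC x) extend_lin rmorphN1 scaleN1r addrC. Qed.

Lemma extendU (K : choiceType) (g : K -> V) k : extend g << k >> = g k.
Proof. by rewrite /extend msuppU oner_eq0 big_seq_fset1 mcoeffUU rmorph1 scale1r. Qed.

Lemma extend_eq0 (K : choiceType) (g : K -> V) k k' :
  g k = g k' -> extend g (<< k >> - << k' >>) = 0.
Proof. by move=> e; rewrite extendB !extendU e subrr. Qed.

Lemma extend_scale_eq0 (K : choiceType) (g : K -> V) c k k' :
  g k = phi c *: g k' -> extend g (<< k >> - c *: << k' >>) = 0.
Proof. by move=> e; rewrite extendB extendZ !extendU e subrr. Qed.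

Lemma extend_diff_eq0 (K : choiceType) (g : K -> V) c k k' k'' :
  g k - g k' = phi c *: g k'' ->
  extend g (<< k >> - << k' >> - c *: << k'' >>) = 0.
Proof. by move=> e; rewrite !extendB extendZ !extendU e subrr. Qed.

Lemma extend_malg_lin (K K' : choiceType) (g : K' -> V) (h : K -> {malg Zq[K']}) x :
  extend g (lin h x) = extend (fun k => extend g (h k)) x.
Proof.
rewrite /lin [RHS]/extend; elim: (enum_fset (msupp x)) => [|k r IHr].
  by rewrite !big_nil extend0.
by rewrite !big_cons extend_lin IHr.
Qed.

End Extension.

Lemma linear_extend (F : fieldType) (phi : {rmorphism Zq -> F}) (V W : lmodType F)
    (L : {linear V -> W}) (K : choiceType) (g : K -> V) x :
  L (extend phi g x) = extend phi (L \o g) x.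
Proof. by rewrite linear_sum; apply: eq_bigr => k _; rewrite linearZ. Qed.

(** * Webs in the Hecke algebra *)

Lemma web_sumn (w : web) a b : is_word vsrc vtgt w a b -> sumn a = sumn b.
Proof.
elim: w a => [|[[s g] t] w IHw] a /=; first by move/eqP->.
by case/andP=> /eqP-> /IHw <-; rewrite !sumn_cat; case: g => k l /=; lia.
Qed.

Definition qfactF (n : nat) : Qq := \prod_(i < n) qintF i.+1%:Z.

Lemma qfactF_neq0 n : qfactF n != 0.
Proof. by apply/prodf_neq0 => i _; apply: qintFS_neq0. Qed.

Lemma qbinF_fact k l : qbinF (k + l) l = qfactF (k + l) / (qfactF k * qfactF l).
Proof.
elim: l => [|l IHl].
  rewrite /qbinF [qfactF 0]big_ord0 big_ord0 addn0 mulr1 divff //.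
  exact: qfactF_neq0.
rewrite addnS qbinF_recl IHl /qfactF !big_ord_recr /= -/(qfactF _) -/(qfactF k) -/(qfactF l).
by rewrite mulrACA -invfM [in RHS]mulrA; congr (_ / _); rewrite mulrC.
Qed.

Lemma qbinF_assoc k l p :
  qbinF (k + l + p) p * qbinF (k + l) l = qbinF (k + (l + p)) (l + p) * qbinF (l + p) p.
Proof.
(* Only the nonvanishing of the quantum factorials matters. *)
have E (K : fieldType) (x y z a b c : K) :
    y != 0 -> z != 0 -> a != 0 -> b != 0 -> c != 0 ->
    x / (y * c) * (y / (a * b)) = x / (a * z) * (z / (b * c)).
  by move=> *; field; apply/and5P.
by rewrite !qbinF_fact addnA; apply: E; apply: qfactF_neq0.
Qed.

Lemma qbinF1 n : qbinF n 1 = qintF n%:Z.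
Proof. by rewrite /qbinF big_ord1 subr0 [qintF 1](divff qF_den_neq0) divr1. Qed.

Lemma qbinF_pred l : qbinF l.+1 l = qintF l.+1%:Z.
Proof.
rewrite -add1n qbinF_fact /qfactF big_ord1 add1n big_ord_recr /= -/(qfactF l).
by rewrite [qintF 1](divff qF_den_neq0) mul1r mulrC mulKf ?qfactF_neq0.
Qed.

Section WebEvaluation.
Variables (F : fieldType) (psi : {rmorphism Qq -> F}).
Let q := psi qF.
Let phi : {rmorphism Zq -> F} := psi \o val.
Local Notation proj := (proj q).
Local Notation projs := (projs q).

Lemma psi_q_neq0 : q != 0.
Proof. by rewrite fmorph_eq0 qF_neq0. Qed.

Lemma psi_qint n : psi (qintF n%:Z) = qnum q n.
Proof. by rewrite /qintF -exprnN !rmorphM !fmorphV !rmorphB !fmorphV !rmorphXn. Qed.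

Lemma psi_qnum_neq0 n : qnum q n.+1 != 0.
Proof. by rewrite -psi_qint fmorph_eq0 qintFS_neq0. Qed.
Local Notation q0 := psi_q_neq0.
Local Notation qn0 := psi_qnum_neq0.

Lemma psi_qint_sub k l :
  psi (qintF (k.+1%:Z - l.+1%:Z)) = qnum q l.+1 * qnum q k - qnum q k.+1 * qnum q l.
Proof.
rewrite !(rmorphM, rmorphB, fmorphV) /= opprB !expfzDr ?qF_neq0 //.
rewrite -!exprnN -!exprnP !rmorphM /= !(fmorphV, rmorphXn) /= -/q /qnum.
have := qden_neq0 qn0; have := q0; move: q => z z0 zd; rewrite !exprS.
have zd' : z * z - 1 != 0.
  by rewrite -[X in _ - X](divff z0) -mulrBr mulf_neq0.
by field; rewrite zd' z0 !expf_neq0.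
Qed.

(** A split carries the binomial coefficient, so that a digon, a split followed
    by a merge, has the right value. *)
Definition vertex_op o (g : vertex) : hecke F :=
  match g with
  | Merge k l => proj (k + l) o
  | Defs.Split k l => HScale (psi (qbinF (k + l) l)) (proj (k + l) o)
  end.

Fixpoint web_op o (w : web) : hecke F :=
  if w is sl :: w' then HMul (vertex_op (o + sumn sl.1.1) sl.1.2) (web_op o w')
  else HOne F.

Implicit Types (f : hecke_fun q) (s t a b c : seq nat) (u v w : web).

Lemma web_op_cat o u v f :
  act (web_op o (u ++ v)) f = act (web_op o u) (act (web_op o v) f).
Proof. by elim: u => //= sl u IHu; rewrite !actM IHu. Qed.

Lemma web_op_whisker o s t w : web_op o (whisker s w t) = web_op (o + sumn s) w.
Proof.
elim: w => // -[[s' g] t'] w IHw; rewrite /whisker /= -/(whisker s w t) IHw.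
by rewrite sumn_cat addnA.
Qed.

Lemma projs_cat o s t f :
  act (projs o (s ++ t)) f = act (projs o s) (act (projs (o + sumn s) t) f).
Proof.
by elim: s o f => [|k s IHs] o f; rewrite /= ?addn0 // !actM IHs addnA.
Qed.

Lemma trivial_char_projs o s : trivial_char q (projs o s) = 1.
Proof.
elim: s o => //= k s IHs o; rewrite IHs mulr1.
exact: trivial_char_proj q0 qn0 _ _.
Qed.

Lemma projs_idem o s f : act (projs o s) (act (projs o s) f) = act (projs o s) f.
Proof.
elim: s o f => [|k s IHs] o f //=; rewrite !actM.
rewrite -(act_far q0 _ (proj_supported q k o) (projs_supported q (o + k) s) (leqnn _)).
by rewrite (proj_idem q0 qn0) IHs.
Qed.

Lemma vertex_sumn g : sumn (vsrc g) = sumn (vtgt g).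
Proof. by case: g => k l /=; lia. Qed.

Lemma vertex_op_supported o g : supported o (o + sumn (vsrc g)) (vertex_op o g).
Proof. by case: g => k l /=; rewrite ?addn0 (proj_supported q (k + l) o). Qed.

(** The symmetrizer of the thick edge absorbs those of the thin edges. *)
Lemma vertex_op_projs o g f :
  act (vertex_op o g) (act (projs o (vtgt g)) f) = act (vertex_op o g) f.
Proof.
have := projs_supported q o (vtgt g); rewrite -vertex_sumn => sg.
have := trivial_char_projs o (vtgt g); move: (projs _ _) sg => x sx cx.
case: g sx => k l; rewrite [sumn _]/= ?addn0 => sx;
  by rewrite /= ?actZ (proj_act q0 qn0) // cx scale1r.
Qed.

Lemma slice_op_projs o s g t f :
  act (projs o (s ++ vsrc g ++ t))
    (act (vertex_op (o + sumn s) g) (act (projs o (s ++ vtgt g ++ t)) f)) =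
  act (projs o (s ++ vsrc g ++ t)) (act (vertex_op (o + sumn s) g) f).
Proof.
rewrite !projs_cat -vertex_sumn; set o1 := (o + sumn s)%N; set o2 := (o1 + _)%N.
have sA := projs_supported q o s.
have sB := projs_supported q o1 (vsrc g).
have sB' := projs_supported q o1 (vtgt g).
have sV := vertex_op_supported o1 g.
have sC := projs_supported q o2 t.
rewrite -vertex_sumn -/o1 -/o2 in sA sB sB' sV.
have C_V h := act_far q0 h sV sC (leqnn _).
have C_B h := act_far q0 h sB' sC (leqnn _).
have C_A (h : hecke_fun q) : act (projs o s) (act (projs o2 t) h) = act (projs o2 t) (act (projs o s) h).
  by apply: (act_far q0 h sA sC); apply: leq_addr.
have A_V h := act_far q0 h sA sV (leqnn _).
have A_B h := act_far q0 h sA sB (leqnn _).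
rewrite C_B C_A C_V projs_idem -A_V -C_A -A_B projs_idem.
by rewrite vertex_op_projs.
Qed.

(** Symmetrizers may be inserted at the top of a web whose bottom edges carry
    theirs: they travel up from slice to slice. *)
Lemma web_op_projs o w a b f : is_word vsrc vtgt w a b ->
  act (projs o a) (act (web_op o w) (act (projs o b) f))
    = act (projs o a) (act (web_op o w) f).
Proof.
elim: w a => [|[[s g] t] w IHw] a /=.
  by move/eqP->; rewrite !act1 projs_idem.
case/andP=> /eqP-> /IHw{}IHw; rewrite !actM.
by rewrite -slice_op_projs IHw slice_op_projs.
Qed.


Lemma phi_qint z : phi (qint z) = psi (qintF z). Proof. by []. Qed.

Lemma strandE k : sumn (strand k) = k.
Proof. by case: k => //= k; rewrite addn0. Qed.

Lemma web_op_merge1l o s l t f :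
  act (web_op o (merge_at s 1 l t)) f = act (proj l.+1 (o + sumn s)) f.
Proof. by case: l => [|l] //=; rewrite actM act1 add1n. Qed.

Lemma web_op_merge1r o s k t f :
  act (web_op o (merge_at s k 1 t)) f = act (proj k.+1 (o + sumn s)) f.
Proof. by case: k => [|k] //=; rewrite actM act1 addn1. Qed.

Lemma web_op_split1r o s k t f :
  act (web_op o (split_at s k 1 t)) f = qnum q k.+1 *: act (proj k.+1 (o + sumn s)) f.
Proof.
case: k => [|k]; first by rewrite (qnum1 qn0) scale1r.
by rewrite /= actM actZ act1 addn1 qbinF1 psi_qint.
Qed.

Lemma web_op_split1l o s l t f :
  act (web_op o (split_at s 1 l t)) f = qnum q l.+1 *: act (proj l.+1 (o + sumn s)) f.
Proof.
case: l => [|l]; first by rewrite (qnum1 qn0) scale1r.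
by rewrite /= actM actZ act1 add1n qbinF_pred psi_qint.
Qed.

Lemma proj_sub k o l p f : (o <= l)%N -> (l + p <= o + k)%N ->
  act (proj p l) (act (proj k o) f) = act (proj k o) f /\
  act (proj k o) (act (proj p l) f) = act (proj k o) f.
Proof.
move=> le_ol le_p; have := supported_sub le_ol le_p (proj_supported q p l).
have := trivial_char_proj q0 qn0 p l; move: (proj p l) => x cx sx.
by rewrite (act_proj q0 qn0) // (proj_act q0 qn0) // cx !scale1r.
Qed.

Lemma web_op_rung_right o k l f :
  act (web_op o (rung_right k.+1 l)) f
    = qnum q k.+1 *: act (proj k.+1 o) (act (proj l.+1 (o + k)) f).
Proof.
rewrite /rung_right web_op_cat web_op_split1r web_op_merge1l strandE.
by rewrite addn0.
Qed.

Lemma web_op_rung_left o k l f :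
  act (web_op o (rung_left k l.+1)) f
    = qnum q l.+1 *: act (proj l.+1 (o + k)) (act (proj k.+1 o) f).
Proof.
rewrite /rung_left web_op_cat web_op_split1l web_op_merge1r strandE.
by rewrite addn0.
Qed.

(** The defining relations between webs hold in the Hecke algebra, in the presence
    of the symmetrizers of the bottom edges. *)
Lemma web_null_op b c r o f : web_null b c r ->
  extend phi (fun w => act (projs o b) (act (web_op o w) f)) r = 0.
Proof.
case.
- move=> g m h _ _; apply: extend_eq0.
  congr (act _ _); rewrite /left_first /right_first /= !actM !act1 addn0 !sumn_cat -vertex_sumn.
  apply: (act_far q0 _ (vertex_op_supported o g) (vertex_op_supported _ h)).
  by rewrite addnA leq_addr.
- move=> k l p _ _ _; apply: extend_eq0.
  congr (act _ _); rewrite /= !actM !act1 ?addn0 addnA.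
  have [-> _] := @proj_sub (k + l + p) o o (k + l) f (leqnn _) (ltac:(lia)).
  by have [-> _] := @proj_sub (k + l + p) o (o + k) (l + p) f (ltac:(lia)) (ltac:(lia)).
- move=> k l p _ _ _; apply: extend_eq0.
  congr (act _ _); rewrite /= !actM !actZ !act1 ?addn0 !linearZ /= addnA !scalerA.
  have [_ ->] := @proj_sub (k + l + p) o o (k + l) f (leqnn _) (ltac:(lia)).
  have [_ ->] := @proj_sub (k + l + p) o (o + k) (l + p) f (ltac:(lia)) (ltac:(lia)).
  by congr (_ *: _); rewrite -!rmorphM /= mulrC qbinF_assoc addnA mulrC.
- move=> k l _ _; apply: extend_scale_eq0.
  by rewrite /= !actM !actZ !act1 ?addn0 !linearZ /= !(proj_idem q0 qn0).
- move=> [|k] [|l] // _ _; apply: extend_diff_eq0.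
  rewrite (web_op_cat _ (rung_right k.+1 l.+1)) web_op_rung_right web_op_rung_left.
  rewrite (web_op_cat _ (rung_left k.+1 l.+1)).
  rewrite web_op_rung_left web_op_rung_right [web_op _ [::]]/= !act1.
  rewrite phi_qint psi_qint_sub -(proj_square q0 qn0).
  have bE h : act (projs o [:: k.+1; l.+1]) h
            = act (proj k.+1 o) (act (proj l.+1 (o + k.+1)) h) by [].
  rewrite !bE.
  have ab h := act_far q0 h (proj_supported q k.+1 o)
    (proj_supported q l.+1 (o + k.+1)) (leqnn _).
  have aa h := proj_idem q0 qn0 k.+1 o h.
  have bb h := proj_idem q0 qn0 l.+1 (o + k.+1) h.
  have ee h := proj_idem q0 qn0 l.+2 (o + k) h.
  have ee' h := proj_idem q0 qn0 k.+2 o h.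
  have eb (h : hecke_fun q) : act (proj l.+2 (o + k)) (act (proj l.+1 (o + k.+1)) h)
                            = act (proj l.+2 (o + k)) h.
    by apply: (proj_sub _ _ _).2; lia.
  have ea' (h : hecke_fun q) : act (proj k.+2 o) (act (proj k.+1 o) h)
                             = act (proj k.+2 o) h.
    by apply: (proj_sub _ _ _).2; lia.
  rewrite -!pred_Sn.
  set A := proj k.+1 o in ab aa ea' *; set B := proj l.+1 _ in ab bb eb *.
  set E := proj l.+2 _ in ee eb *; set E' := proj k.+2 _ in ee' ea' *.
  clearbody A B E E'.
  rewrite !linearZ /= !linearZ /= ee ee' !scalerA.
  have -> : act E (act A (act B f)) = act E (act A f) by rewrite ab eb.
  rewrite ea' bb -(ab (act E _)) aa.
  by rewrite (mulrC (qnum q l.+2)) (mulrC (qnum q k.+2)).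
Qed.

Definition scaled_value (z : F) (x : hecke F) f : F^o := z * act x f [::].
Fact scaled_value_linear z x : linear (scaled_value z x).
Proof.
move=> y f g; rewrite /scaled_value linearD linearZ /= !hecke_funE /GRing.scale /=.
by rewrite mulrDr mulrCA.
Qed.
HB.instance Definition _ z x :=
  GRing.isLinear.Build F (hecke_fun q) F^o _ (scaled_value z x) (scaled_value_linear z x).

(** * Values of annular webs and of brackets *)

Section Trace.
Variables (a : F) (P : link_diagram -> F).
Hypotheses (a_neq0 : a != 0) (circle1_neq0 : circle1 q a != 0).
Hypothesis invP : link_invariant P.
Hypothesis skeinP : forall Lp Lm L0, skein_triple Lp Lm L0 ->
  a^-1 * P Lp - a * P Lm = (q^-1 - q) * P L0.
Hypothesis unknotP : P unknot = circle1 q a.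

Let tr : hecke_fun q := trace q0 qn0 a_neq0 circle1_neq0 invP skeinP.

(** The power of c_1 compensates for the normalization of the trace by the number
    of strands. *)
Definition annular_value (x : annular_web) : F^o :=
  circle1 q a ^+ sumn x.1 * act (projs 0 x.1) (act (web_op 0 x.2) tr) [::].

Lemma annular_value_circles s : annular_value (s, [::]) = \prod_(k <- s) circle q a k.
Proof.
rewrite /annular_value /= act1 /tr.
exact: (trace_projs q0 qn0 a_neq0 circle1_neq0 invP skeinP unknotP s).
Qed.

(** Rotation is the trace property.  For a local relation, the symmetrizers of the
    edges just below it are inserted, so that [web_null_op] applies. *)
Lemma annular_value_null x : annular_null x -> extend phi annular_value x = 0.
Proof.
elim=> [|c y z _ IHy _ IHz|b c u v wu wv|b c c' s t u v r rnull wu wv].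
- exact: extend0.
- by rewrite extend_lin IHy IHz scaler0 addr0.
- apply: extend_eq0; rewrite /annular_value /=.
  have /and3P[wu' _ _] := wu; have /and3P[wv' _ _] := wv.
  rewrite (web_sumn wu') !web_op_cat; congr (_ * _).
  rewrite -(web_op_projs 0 _ wu') -(web_op_projs 0 (act (web_op 0 u) tr) wv').
  rewrite -[LHS]/(act (HMul (projs 0 b) (web_op 0 u))
                      (act (HMul (projs 0 c) (web_op 0 v)) tr) [::]).
  by rewrite trace_comm !actM.
- rewrite extend_malg_lin.
  have /and3P[wu' _ _] := wu.
  pose o := sumn s; pose f := act (web_op 0 v) tr.
  pose y := HMul (HMul (projs 0 b) (web_op 0 u))
                 (HMul (projs 0 s) (projs (o + sumn c) t)).
  pose g w := act (projs o c) (act (web_op o w) f).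
  have sC := projs_supported q (o + sumn c) t.
  have sB := projs_supported q o c.
  have E w : extend phi annular_value << (b, u ++ whisker s w t ++ v) >>
           = scaled_value (circle1 q a ^+ sumn b) y (g w).
    rewrite extendU /annular_value /scaled_value /= !web_op_cat web_op_whisker add0n.
    rewrite -(web_op_projs 0 _ wu') !projs_cat add0n -/o -/f.
    by rewrite (act_far q0 _ sB sC (leqnn _)).
  transitivity (extend phi (scaled_value (circle1 q a ^+ sumn b) y \o g) r).
    by apply: eq_bigr => w _; rewrite E.
  by rewrite -linear_extend (web_null_op o f rnull) linear0.
Qed.

Fixpoint bracket_fun (beta : seq (bool * nat)) : hecke_fun q :=
  if beta is (e, i) :: beta' then
    - (if e then q else q^-1) *: bracket_fun beta' + act (HGen F i) (bracket_fun beta')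
  else tr.

Definition braid_letters m (beta : braid m) : seq (bool * nat) :=
  [seq (x.1, val x.2) | x : bool * 'I_m <- beta].

Lemma dumbbell_op m (i : 'I_m) w f :
  act (web_op 0 (dumbbell i ++ w)) f = act (HGen F i) (act (web_op 0 w) f).
Proof.
rewrite web_op_cat /= !actM act1 actZ linearZ /= (proj_idem q0 qn0).
by rewrite qbinF1 psi_qint sumn_nseq mul1n add0n (qnum_proj2 qn0).
Qed.

Lemma phi_qpow1 : phi (qpow 1) = q. Proof. by []. Qed.
Lemma phi_qpowN1 : phi (qpow (-1)) = q^-1.
Proof. by rewrite -[LHS]/(psi (qF^-1)) fmorphV. Qed.

Lemma extend_bracket m (beta : braid m) :
  extend phi (fun w => act (web_op 0 w) tr) (bracket beta)
    = bracket_fun (braid_letters beta).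
Proof.
elim: beta => [|[e i] beta IHb] /=; first by rewrite extendU.
apply: etrans (extend_lin _ _ _ _ _) _; rewrite -IHb.
have -> : phi (if e then - qpow 1 else - qpow (-1)) = - (if e then q else q^-1).
  by case: e; rewrite rmorphN ?phi_qpow1 ?phi_qpowN1.
apply: congr1; apply: etrans (extend_malg_lin _ _ _ _) _.
rewrite linear_extend; apply: eq_bigr => w _.
by rewrite extendU dumbbell_op.
Qed.

Definition letters_writhe (beta : seq (bool * nat)) : int :=
  \sum_(x <- beta) (if x.1 then 1 else -1).

(** The bracket of a crossing, -q + E or E - q^-1, acts on [trace] as the crossing
    itself: for a positive one this is the definition of E, and a negative one is
    exchanged for a positive one by the skein relation. *)
Lemma bracket_funE n beta (v : seq nat) :
  on_strands n.+1 beta -> on_strands n.+1 (positive v) ->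
  bracket_fun beta v =
    a ^- size v * a ^ (- letters_writhe beta)
    * closure_value P 0 n.+1 (positive v ++ beta) / circle1 q a ^+ n.+1.
Proof.
rewrite /letters_writhe; elim: beta v => [|[e i] beta IHb] v hb hv.
  rewrite big_nil oppr0 expr0z mulr1 cats0 -[LHS]/(trace_val q a P v).
  exact: (trace_valE q0 qn0 a_neq0 circle1_neq0 invP skeinP).
case/andP: hb => hi hb; have {}hi : (i.+1 < n.+1)%N := hi.
rewrite big_cons opprD expfzDr // [bracket_fun _]/=.
have hvi : on_strands n.+1 (positive (rcons v i)).
  by rewrite /positive map_rcons /on_strands all_rcons /= hi.
rewrite hecke_funD hecke_funZ act_genE (IHb v hb hv) (IHb (rcons v i) hb hvi).
rewrite size_rcons /positive map_rcons -/(positive v) cat_rcons.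
set A := a ^ (- \sum_(x <- beta) _).
case: e {hvi} => /=.
  rewrite exprN1 (exprS a); move: A => A; field.
  by rewrite a_neq0 ?circle1_neq0 !expf_neq0.
have := closure_value_skein skeinP hv hb hi.
set Cp := closure_value _ _ _ (_ ++ (true, i) :: _).
set Cm := closure_value _ _ _ (_ ++ (false, i) :: _).
set C0 := closure_value _ _ _ (positive v ++ beta) => sk.
have -> : Cm = a^-1 * (a^-1 * Cp - (q^-1 - q) * C0) by rewrite -sk subKr mulKf.
rewrite opprK expr1z (exprS a); move: A => A; field.
by rewrite a_neq0 ?circle1_neq0 q0 !expf_neq0.
Qed.

Lemma braid_letters_on_strands m (beta : braid m) :
  on_strands m.+1 (braid_letters beta).
Proof.
by rewrite /on_strands all_map; apply/allP => -[e i] _; rewrite /= ltnS ltn_ord.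
Qed.

Lemma braid_closureE m (beta : braid m) :
  closure_value P 0 m.+1 (braid_letters beta) = P (braid_closure beta).
Proof.
rewrite /closure_value (word_valueE _ _ (closure_wordP (braid_letters_on_strands beta))).
congr P; rewrite /braid_closure.
have E : closure_word m.+1 (braid_letters beta) = cups m.+1 ++ braid_word beta ++ caps m.+1.
  by rewrite /closure_word /crossings /braid_letters -map_comp.
move: (closure_wordP _) (braid_closure_word _); rewrite E => h h'.
by congr LinkDiagram; apply: bool_irrelevance.
Qed.

Lemma projs_nseq1 o n f : act (projs o (nseq n 1%N)) f = f.
Proof. by elim: n o => // n IHn o; rewrite /= actM IHn. Qed.

Lemma closed_bracket_value m (beta : braid m) :
  extend phi annular_value (closed_bracket beta)
    = a ^ (- writhe beta) * P (braid_closure beta).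
Proof.
rewrite extend_malg_lin.
transitivity (extend phi
    (scaled_value (circle1 q a ^+ m.+1) (HOne F) \o (fun w => act (web_op 0 w) tr))
    (bracket beta)).
  apply: eq_bigr => w _; rewrite extendU /annular_value /scaled_value /=.
  by rewrite -/(nseq m.+1 1%N) actM projs_nseq1 act1 sumn_nseq mul1n.
rewrite -linear_extend extend_bracket /= /scaled_value act1.
rewrite (@bracket_funE m) ?braid_letters_on_strands // expr0 invr1 mul1r braid_closureE.
rewrite mulrCA divff ?expf_neq0 // mulr1 /letters_writhe /writhe.
by rewrite /braid_letters big_map.
Qed.

Theorem braid_closure_value m (beta : braid m) x :
  annular_evaluation beta x ->
  P (braid_closure beta)
    = a ^ writhe beta * eval_circles (fun z : Zq => psi (Zq_val z)) (circle q a) x.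
Proof.
case=> _ /annular_value_null; rewrite extendB closed_bracket_value => /eqP.
rewrite subr_eq0 => /eqP E.
rewrite -[LHS](mulVKf (expfz_neq0 (writhe beta) a_neq0)) invr_expz E; congr (_ * _).
rewrite extend_malg_lin; apply: eq_bigr => s _.
by rewrite extendU annular_value_circles.
Qed.
End Trace.
End WebEvaluation.

(** * The two specializations *)

Lemma circle_qbin n k : (0 < n)%N -> circle qF (qF ^+ n) k = qbinF (n + k - 1) k.
Proof.
case: n => // n _; elim: k => [|k IHk]; first by rewrite /circle /qbinF !big_ord0.
have -> : (n.+1 + k.+1 - 1 = (n.+1 + k - 1).+1)%N by lia.
rewrite qbinF_recl -IHk /circle big_ord_recr /= mulrC; congr (_ * _).
have -> : ((n.+1 + k - 1).+1 = n.+1 + k)%N by lia.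
rewrite /qintF -!exprnN -!exprnP exprD invf_div mulrA divfK //.
exact: qF_den_neq0.
Qed.

Lemma circle_sym (F : fieldType) (q a : F) k :
  q != 0 -> a != 0 -> (forall n, qnum q n.+1 != 0) ->
  circle q a k = q ^+ k * a ^- k *
    \prod_(1 <= i < k.+1) ((1 - a ^+ 2 * q ^+ (2 * i - 2)) / (1 - q ^+ (2 * i))).
Proof.
move=> q0 a0 qn0; elim: k => [|k IHk].
  by rewrite /circle big_ord0 big_geq // expr0 invr1 !mulr1.
rewrite big_nat_recr // /circle big_ord_recr -/(circle q a k) IHk.
have -> : (2 * k.+1 - 2 = k * 2)%N by lia.
have -> : (2 * k.+1 = k.+1 * 2)%N by lia.
set p := \prod_(_ <= _ < _) _; rewrite !(exprM _ _ 2) !exprS.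
have := qn0 k; rewrite /qnum mulf_eq0 negb_or exprS => /andP[nz _].
have x0 : q ^+ k != 0 by rewrite expf_neq0.
have y0 : a ^+ k != 0 by rewrite expf_neq0.
have nz' : 1 - q * q ^+ k * (q * q ^+ k) != 0.
  rewrite -[X in X - _](@divff _ (q * q ^+ k)) ?mulf_neq0 // -mulrBr mulf_neq0 ?mulf_neq0 //.
  by rewrite -oppr_eq0 opprB.
move: (q ^+ k) (a ^+ k) p x0 y0 nz nz' => X Y p x0 y0 nz nz'.
rewrite /=; field.
by rewrite nz' y0 a0 x0 q0 -oppr_eq0 opprB.
Qed.

Lemma circle1_neq0 (F : fieldType) (q a : F) :
  q - q^-1 != 0 -> a - a^-1 != 0 -> circle1 q a != 0.
Proof. by move=> qd ad; rewrite mulf_neq0 ?invr_eq0. Qed.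

Lemma aK_neq0 : aK != 0.
Proof. by rewrite /aK tofrac_eq0 polyX_eq0. Qed.

Lemma aK_neqV : aK - aK^-1 != 0.
Proof.
have : aK ^+ 2 != 1.
  rewrite /aK -tofracXn -tofrac1 tofrac_eq; apply/eqP => /(congr1 (size \o val)) /=.
  by rewrite size_polyXn size_poly1.
by apply: contraNneq => /eqP; rewrite subr_eq0 => /eqP e; rewrite expr2 {2}e divff ?aK_neq0.
Qed.

Theorem proposition1p4 (m : nat) (beta : braid m) (x : {malg Zq[circles]})
    (hx : annular_evaluation beta x) :
  (forall (n : nat) (P : link_diagram -> Zq), (0 < n)%N -> sln_polynomial n P ->
     P (braid_closure beta) =
       qpow (n%:Z * writhe beta)
       * eval_circles id (fun k => qbin (n + k - 1) k) x)
  /\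
  (forall P : link_diagram -> Qqa, HOMFLYPT_polynomial P ->
     P (braid_closure beta) =
       aK ^ writhe beta * eval_circles Zq_Qqa cSym x).
Proof.
split=> [n P n_gt0 [invP skeinP unknotP]|P [invP skeinP unknotP]].
- have a0 : qF ^+ n != 0 by rewrite expf_neq0 // qF_neq0.
  have c1 : circle1 qF (qF ^+ n) = qintF n%:Z.
    by rewrite /circle1 /qintF -exprnN.
  have c1_neq0 : circle1 qF (qF ^+ n) != 0.
    by rewrite c1 -(prednK n_gt0) qintFS_neq0.
  apply: val_inj; have -> : val (P (braid_closure beta)) =
      (qF ^+ n) ^ writhe beta * eval_circles Zq_val (circle qF (qF ^+ n)) x.
    apply: (@braid_closure_value _ idfun _ (fun L => Zq_val (P L)) a0 c1_neq0).
    + by move=> L L' /invP->.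
    + move=> Lp Lm L0 /skeinP/(congr1 val).
      by rewrite !(rmorphB, rmorphM) /= -exprnN.
    + by rewrite unknotP [RHS]c1.
    + exact: hx.
  rewrite /eval_circles [RHS]rmorphM rmorph_sum; congr (_ * _).
    by rewrite exprnP; apply: exprz_exp.
  apply: eq_bigr => s _.
  rewrite rmorphM rmorph_prod; congr (_ * _); apply: eq_bigr => k _.
  exact: circle_qbin.
- pose psi : {rmorphism Qq -> Qqa} := @tofrac {poly Qq} \o polyC.
  have qn0 : forall n, qnum qK n.+1 != 0 by exact: (psi_qnum_neq0 psi).
  have q0 : qK != 0 by exact: (psi_q_neq0 psi).
  have c1_neq0 := circle1_neq0 (qden_neq0 qn0) aK_neqV.
  rewrite (@braid_closure_value _ psi aK P aK_neq0 c1_neq0 invP skeinP unknotP m beta x hx).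
  congr (_ * _); apply: eq_bigr => s _; congr (_ * _); apply: eq_bigr => k _.
  exact: circle_sym q0 aK_neq0 qn0.
Qed.
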